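(* Let $0 < \kappa < 1$, $\lambda = \sqrt{1-\kappa^2}$, and let $P_\kappa = \wp(\,\cdot\,; G_2, G_3)$ with $G_2 = 48(1 + 8\kappa^2)$ and $G_3 = 64(1 - 20\kappa^2 - 8\kappa^4)$. The period lattice of $P_\kappa$ is rectangular, generated by $2\Omega_\kappa$ and $2\Omega_\kappa'$ with $\Omega_\kappa > 0$ real and $\Omega_\kappa'$ purely imaginary with positive imaginary part. Then $$\Omega_\kappa' = {\rm i}\, \tfrac{1}{6\sqrt2}\, \pi \,_2F_1 (\tfrac{1}{3}, \tfrac{2}{3}; 1; \lambda^2).$$
   Context: $\wp(\,\cdot\,; g_2, g_3)$ denotes the Weierstrass elliptic function with invariants $g_2, g_3$; $\,_2F_1$ is the Gauss hypergeometric function. *)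

(* Defs.v *)
From Stdlib Require Import Reals ZArith List.
From Coquelicot Require Import Coquelicot.
Open Scope R_scope.

Definition lattice_pt (w1 w2 : C) (m n : Z) : C :=
  Cplus (Cmult (RtoC (2 * IZR m)) w1) (Cmult (RtoC (2 * IZR n)) w2).

Definition zrange (N : nat) : list Z :=
  map (fun k => (Z.of_nat k - Z.of_nat N)%Z) (seq 0 (2 * N + 1)).

Definition eis_partial (k : nat) (w1 w2 : C) (N : nat) : C :=
  fold_right Cplus (RtoC 0)
    (flat_map (fun m =>
       map (fun n =>
         if (Z.eqb m 0 && Z.eqb n 0)%bool then RtoC 0
         else Cinv (Cpow (lattice_pt w1 w2 m n) k))
       (zrange N)) (zrange N)).

(** The (absolutely convergent, k >= 3) lattice sum  sum'_{w in Lambda} w^(-k)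
    equals s. *)
Definition is_eisenstein (k : nat) (w1 w2 : C) (s : C) : Prop :=
  filterlim (eis_partial k w1 w2) eventually (locally s).

(** The lattice generated by 2 w1, 2 w2 has Weierstrass invariants g2, g3:
    g2 = 60 sum' w^-4,  g3 = 140 sum' w^-6.  Equivalently, wp(.; g2, g3) is the
    Weierstrass function of this lattice, i.e. this is its period lattice. *)
Definition has_invariants (w1 w2 : C) (g2 g3 : R) : Prop :=
  is_eisenstein 4 w1 w2 (RtoC (g2 / 60)) /\ is_eisenstein 6 w1 w2 (RtoC (g3 / 140)).

Fixpoint pochhammer (a : R) (n : nat) : R :=
  match n with
  | O => 1
  | S n' => pochhammer a n' * (a + INR n')
  end.

Definition hyp2F1 (a b c x : R) : R :=
  Series (fun n => pochhammer a n * pochhammer b n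
                   / (pochhammer c n * INR (fact n)) * x ^ n).

(* Main.v *)
Require Import Defs.
From Stdlib Require Import Reals Lra Lia ZArith List Ranalysis5.
From Coquelicot Require Import Coquelicot.
Import ListNotations.
Open Scope R_scope.

(** Write [Omega = Om] and [Omega' = i s].  Summing the lattice along the rows parallel to
    [Omega'] turns [g2] and [g3] into multiples of [E4 = 1 + 240 sum d^3 q^d/(1 - q^d)] and
    [E6 = 1 - 504 sum d^5 q^d/(1 - q^d)] with [q = exp (- h)], [h = 2 PI Om / s]; a row is
    evaluated by iterating the duplication formula of [1/sin^2].

    With [L_m = 1/(e^(m h) - 1)] one has [L_m L_n = L_(m+n) (1 + L_m + L_n)].  Take a symmetric
    form [f] such that [f m (n - m)] is again symmetric.  The addition rule identifies the
    difference between the sum of [f m n L_m L_n] over [m + n <= N] and that of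
    [f m (n - m) L_m L_n] over the square [m, n <= N] with a single sum; for three forms, this
    gives Ramanujan's differential equations for [E2, E4, E6].

    Parametrize [E4 = a^4 (1 - 8x/9)], [E6 = a^6 (1 - 4x/3 + 8x^2/27)].  Ramanujan's equations
    say that [a], as a function of [x], solves the equation of [2F1(1/3, 2/3; 1; x)].  As
    [h -> oo] one has [x -> 0], [a -> 1] and the Wronskian tends to [0], so that
    [a = 2F1(1/3, 2/3; 1; x)] everywhere.  For the given invariants [x = 1 - kappa^2] and
    [a = 6 sqrt 2 s / PI]. *)

(** * Dominated convergence of series *)

Lemma is_series_norm_le {K : AbsRing} {V : NormedModule K}
  (a : nat -> V) (b : nat -> R) (la : V) (lb : R) :
  is_series a la -> is_series b lb -> (forall n, norm (a n) <= b n) -> norm la <= lb.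
Proof.
  intros Ha Hb Hab.
  apply (filterlim_le (F := eventually) (fun n => norm (sum_n a n)) (sum_n b) (norm la) lb).
  - exists 0%nat; intros n _.
    eapply Rle_trans; [apply norm_sum_n_m | apply sum_n_m_le; exact Hab].
  - exact (filterlim_comp _ _ _ _ _ _ _ _ Ha (filterlim_norm la)).
  - exact Hb.
Qed.

Lemma is_series_tail {K : AbsRing} {V : NormedModule K} (a : nat -> V) (l : V) (N : nat) :
  is_series a l -> is_series (fun k => a (S N + k)%nat) (minus l (sum_n a N)).
Proof.
  intros Ha. apply is_series_incr_n; [lia|].
  replace (plus _ _) with l; [exact Ha|].
  unfold minus. rewrite <- plus_assoc. etransitivity; [symmetry; apply plus_zero_r|].
  f_equal. symmetry. exact (plus_opp_l (sum_n a N)).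
Qed.

Lemma filterlim_sum_n {T : Type} {F : (T -> Prop) -> Prop} {FF : Filter F}
  {K : AbsRing} {V : NormedModule K} (a : T -> nat -> V) (l : nat -> V) (N : nat) :
  (forall n, filterlim (fun x => a x n) F (locally (l n))) ->
  filterlim (fun x => sum_n (a x) N) F (locally (sum_n l N)).
Proof.
  intros H; induction N as [|N IH].
  - rewrite sum_O. apply filterlim_ext with (2 := H 0%nat). intros x; rewrite sum_O; auto.
  - rewrite sum_Sn.
    apply filterlim_ext with (fun x => plus (sum_n (a x) N) (a x (S N))).
    { intros x; rewrite sum_Sn; auto. }
    eapply filterlim_comp_2; [exact IH | exact (H (S N)) | apply filterlim_plus].
Qed.

Lemma filterlim_series_dominated {T : Type} {F : (T -> Prop) -> Prop} {FF : ProperFilter F}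
  {K : AbsRing} {V : CompleteNormedModule K}
  (a : T -> nat -> V) (s : T -> V) (l : nat -> V) (b : nat -> R) :
  ex_series b ->
  F (fun x => is_series (a x) (s x) /\ forall n, norm (a x n) <= b n) ->
  (forall n, filterlim (fun x => a x n) F (locally (l n))) ->
  exists L : V, is_series l L /\ filterlim s F (locally L).
Proof.
  intros [B HB] Hdom Hl.
  set (dom x := is_series (a x) (s x) /\ forall n, norm (a x n) <= b n) in Hdom.
  destruct (filterlim_switch_dom eventually eventually_filter F _ dom
    ltac:(intros P HP; apply filter_ex, (filter_and _ _ Hdom HP))
    (fun N x => sum_n (a x) N) s (fun N => sum_n l N)) as [L [H1 H2]].
  - apply filterlim_locally; intros eps.
    destruct (proj1 (filterlim_locally_ball_norm (K := R_AbsRing) _ _) HB eps) as [N0 HN0].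
    exists N0; intros N HN [x [Hs Hle]]; simpl.
    apply (norm_compat1 (V := V)), Rle_lt_trans with (2 := HN0 N HN).
    assert (Htail : norm (minus (s x) (sum_n (a x) N)) <= minus B (sum_n b N)).
    { apply (is_series_norm_le _ _ _ _ (is_series_tail _ _ N Hs) (is_series_tail _ _ N HB)).
      intros k; apply Hle. }
    rewrite <- norm_opp, opp_minus. eapply Rle_trans; [exact Htail|].
    change (B - sum_n b N <= Rabs (sum_n b N - B)). rewrite Rabs_minus_sym. apply Rle_abs.
  - intros N P HP.
    apply (filter_imp (F := F) (fun x => P (sum_n (a x) N))); [auto|].
    exact (filterlim_sum_n a l N Hl P HP).
  - exists L; split; [exact H1|].
    intros P HP. generalize (filter_and _ _ Hdom (H2 P HP)).
    apply (filter_imp (F := F)); intros x [Hx HPx]; auto.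
Qed.

Lemma is_series_finite_support {K : AbsRing} {V : NormedModule K} (a : nat -> V) (N : nat) :
  (forall n, (N < n)%nat -> a n = zero) -> is_series a (sum_n a N).
Proof.
  intros H. apply filterlim_ext_loc with (fun _ => sum_n a N); [|apply filterlim_const].
  exists N; intros n Hn. induction Hn as [|n Hn IH]; auto.
  rewrite sum_Sn, <- IH, H, plus_zero_r by lia; auto.
Qed.

Lemma is_series_zero {K : AbsRing} {V : NormedModule K} :
  is_series (fun _ => zero : V) zero.
Proof.
  assert (H := is_series_finite_support (fun _ => zero : V) 0 ltac:(auto)).
  rewrite sum_O in H; exact H.
Qed.

Lemma is_series_sum_f_R0 (a : nat -> R) (l : R) :
  is_series a l <-> is_lim_seq (sum_f_R0 a) l.
Proof.
  split; apply filterlim_ext; intros n; rewrite sum_n_Reals; reflexivity.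
Qed.

Lemma ex_series_Rabs_le (a b : nat -> R) :
  (forall n, Rabs (a n) <= b n) -> ex_series b -> ex_series a.
Proof. intros H; apply (ex_series_le (V := R_CompleteNormedModule) a b H). Qed.

Lemma ex_series_inv_sq : ex_series (fun n => / INR (S n) ^ 2).
Proof.
  set (a := fun n => / INR (S n) ^ 2).
  assert (Ha : forall n, 0 < a n) by (intros n; apply Rinv_0_lt_compat, pow_lt, lt_0_INR; lia).
  assert (Hsum : forall n, sum_f_R0 a n <= 2 - / INR (S n)).
  { induction n as [|n IH]; [unfold a; simpl; lra|].
    rewrite tech5. apply Rle_trans with (2 - / INR (S n) + a (S n)); [lra|].
    unfold a. rewrite (S_INR (S n)). assert (Hn : 0 < INR (S n)) by (apply lt_0_INR; lia).
    set (m := INR (S n)) in *.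
    apply Rminus_le.
    replace (2 - / m + / (m + 1) ^ 2 - (2 - / (m + 1))) with (- / (m * (m + 1) ^ 2))
      by (field; lra).
    apply Ropp_le_cancel; rewrite Ropp_0, Ropp_involutive.
    left; apply Rinv_0_lt_compat, Rmult_lt_0_compat; [|apply pow_lt]; lra. }
  destruct (ex_finite_lim_seq_incr (sum_f_R0 a) 2) as [l Hl].
  - intros n; rewrite tech5; specialize (Ha (S n)); lra.
  - intros n; specialize (Hsum n).
    assert (0 < / INR (S n)) by (apply Rinv_0_lt_compat, lt_0_INR; lia). lra.
  - exists l; apply is_series_sum_f_R0; exact Hl.
Qed.

Lemma sum_n_le_is_series (a : nat -> R) (l : R) (N : nat) :
  (forall n, 0 <= a n) -> is_series a l -> 0 <= sum_n a N <= l.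
Proof.
  intros Ha Hl. split.
  - rewrite sum_n_Reals. apply cond_pos_sum; exact Ha.
  - apply (is_lim_seq_incr_compare (sum_n a) l Hl). intros n.
    rewrite sum_Sn. unfold plus; simpl. specialize (Ha (S n)); lra.
Qed.

Lemma is_series_sum_n {K : AbsRing} {V : NormedModule K} (u : nat -> nat -> V) (g : nat -> V)
  (N : nat) :
  (forall m, is_series (u m) (g m)) ->
  is_series (fun n => sum_n (fun m => u m n) N) (sum_n g N).
Proof.
  intros H; induction N as [|N IH].
  - rewrite sum_O. apply is_series_ext with (2 := H 0%nat). intros n; rewrite sum_O; auto.
  - rewrite sum_Sn. apply is_series_ext with (2 := is_series_plus _ _ _ _ IH (H (S N))).
    intros n; rewrite sum_Sn; auto.
Qed.

Lemma is_series_Tonelli (u : nat -> nat -> R) (g l : nat -> R) (s : R) :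
  (forall m n, 0 <= u m n) ->
  (forall m, is_series (u m) (g m)) -> (forall n, is_series (fun m => u m n) (l n)) ->
  is_series l s -> is_series g s.
Proof.
  intros Hu Hg Hl Hs.
  destruct (filterlim_series_dominated (F := eventually) (V := R_CompleteNormedModule)
    (fun N n => sum_n (fun m => u m n) N) (sum_n g) l l (ex_intro _ s Hs)) as [L [HL1 HL2]].
  - apply filter_forall; intros N; split; [exact (is_series_sum_n (V := R_NormedModule) u g N Hg)|].
    intros n. destruct (sum_n_le_is_series _ _ N (fun m => Hu m n) (Hl n)) as [H0 H1].
    unfold norm; simpl; unfold abs; simpl. rewrite Rabs_pos_eq; auto.
  - exact Hl.
  - rewrite <- (is_series_unique l s Hs), (is_series_unique l L HL1). exact HL2.
Qed.

Lemma is_derive_filterlim_quotient (f : R -> R) (x l : R) :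
  is_derive f x l <->
  filterlim (fun e => (f (x + e) - f x) / e) (locally' 0) (locally l).
Proof.
  rewrite is_derive_Reals, filterlim_locally. split; intros H eps.
  - destruct (H eps (cond_pos eps)) as [d Hd]. exists d; intros e He He0.
    apply Hd; auto. rewrite <- (Rminus_0_r e); exact He.
  - intros He. destruct (H (mkposreal eps He)) as [d Hd]. exists d; intros e He0 Hed.
    apply Hd; auto. rewrite <- (Rminus_0_r e) in Hed; exact Hed.
Qed.

Lemma is_derive_Series_dominated (f df : nat -> R -> R) (b : nat -> R) (x d : R) :
  0 < d -> ex_series b ->
  (forall y, Rabs (y - x) < d -> ex_series (fun n => f n y)) ->
  (forall n y, Rabs (y - x) < d -> is_derive (f n) y (df n y)) ->
  (forall n y, Rabs (y - x) < d -> Rabs (df n y) <= b n) ->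
  is_derive (fun y => Series (fun n => f n y)) x (Series (fun n => df n x)).
Proof.
  intros Hd Hb Hex Hder Hle.
  assert (Hx : Rabs (x - x) < d) by (rewrite Rminus_eq_0, Rabs_R0; exact Hd).
  apply is_derive_filterlim_quotient.
  destruct (filterlim_series_dominated (F := locally' 0) (FF := Rbar_locally'_filter 0)
    (V := R_CompleteNormedModule) (fun e n => (f n (x + e) - f n x) / e)
    (fun e => (Series (fun n => f n (x + e)) - Series (fun n => f n x)) / e)
    (fun n => df n x) b Hb) as [L [HL1 HL2]].
  - exists (mkposreal d Hd); intros e He He0.
    assert (Ee : x + e - x = e :> R) by ring.
    assert (Hxe : Rabs (x + e - x) < d) by (rewrite Ee, <- (Rminus_0_r e); exact He).
    split.
    + exact (is_series_scal_r (/ e) _ _ (is_series_minus _ _ _ _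
        (Series_correct _ (Hex _ Hxe)) (Series_correct _ (Hex _ Hx)))).
    + intros n. destruct (MVT_cor4 (f n) (df n) x (Rabs e)) with (x + e) as [c [Hc Hcx]].
      * intros c Hc; apply Hder. rewrite Ee in Hxe. lra.
      * rewrite Ee; apply Rle_refl.
      * rewrite Hc, Ee. replace (df n c * e / e) with (df n c) by (field; auto).
        apply Hle. rewrite Ee in Hcx, Hxe. lra.
  - intros n; apply is_derive_filterlim_quotient; auto.
  - rewrite (is_series_unique (fun n => df n x) L HL1). exact HL2.
Qed.

(** * Lambert series *)

Lemma PS_incr_derive (u : nat -> R) (n : nat) : PS_incr_1 (PS_derive u) n = INR n * u n.
Proof. destruct n; [simpl; unfold zero; simpl; ring | reflexivity]. Qed.

Lemma CV_radius_INR_pow (j : nat) : Rbar_le 1 (CV_radius (fun n => INR n ^ j)).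
Proof.
  induction j as [|j IH].
  - apply (CV_radius_bounded (fun n => INR n ^ 0)). exists 1.
    intros n; simpl; rewrite pow1, Rmult_1_r, Rabs_R1; lra.
  - rewrite (CV_radius_ext _ (PS_incr_1 (PS_derive (fun n => INR n ^ j)))).
    + rewrite CV_radius_incr_1, CV_radius_derive; exact IH.
    + intros n; rewrite PS_incr_derive; reflexivity.
Qed.

Lemma is_series_PSeries (a : nat -> R) (x : R) :
  Rbar_lt (Rabs x) (CV_radius a) -> is_series (fun n => a n * x ^ n) (PSeries a x).
Proof. intros H. apply Series_correct, ex_series_Rabs, CV_disk_inside; auto. Qed.

Lemma ex_series_INR_pow_geom (j : nat) (w : R) :
  Rabs w < 1 -> ex_series (fun n => INR n ^ j * w ^ n).
Proof.
  intros Hw. eexists. apply (is_series_PSeries (fun n => INR n ^ j)).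
  apply Rbar_lt_le_trans with 1; [exact Hw | apply CV_radius_INR_pow].
Qed.

Lemma exp_neg_bounds (h : R) : 0 < h -> 0 < exp (- h) < 1.
Proof. intros H; split; [apply exp_pos | rewrite <- exp_0; apply exp_increasing; lra]. Qed.

Lemma exp_INR_mult (a : nat) (h : R) : exp (INR a * h) = exp h ^ a.
Proof.
  induction a as [|a IH]; [simpl; rewrite Rmult_0_l; apply exp_0|].
  rewrite S_INR, Rmult_plus_distr_r, exp_plus, IH, Rmult_1_l; simpl; ring.
Qed.

Lemma exp_INR_mult_gt_1 (a : nat) (h : R) : (0 < a)%nat -> 0 < h -> 1 < exp (INR a * h).
Proof.
  intros Ha Hh. rewrite <- exp_0. apply exp_increasing, Rmult_lt_0_compat; auto.
  apply lt_0_INR; auto.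
Qed.

(* At [a = 0] the denominator vanishes and the value is [/ 0 = 0], so that the index [0]
   contributes to none of the sums below. *)
Definition bose (a : nat) (h : R) : R := / (exp (INR a * h) - 1).

Definition lambert (e i : nat) (h : R) : R := Series (fun a => INR a ^ i * bose a h ^ e).

Lemma bose_0 (h : R) : bose 0 h = 0.
Proof. unfold bose; simpl. rewrite Rmult_0_l, exp_0, Rminus_eq_0. apply Rinv_0. Qed.

Lemma bose_mult (a b : nat) (h : R) :
  0 < h -> (0 < a)%nat -> (0 < b)%nat ->
  bose a h * bose b h = bose (a + b) h * (1 + bose a h + bose b h).
Proof.
  intros Hh Ha Hb. unfold bose.
  assert (H1 := exp_INR_mult_gt_1 a h Ha Hh).
  assert (H2 := exp_INR_mult_gt_1 b h Hb Hh).
  rewrite plus_INR, Rmult_plus_distr_r, exp_plus.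
  field. repeat split; nra.
Qed.

Lemma bose_geom (a : nat) (h : R) :
  0 < h -> (0 < a)%nat -> bose a h = exp (- h) ^ a / (1 - exp (- h) ^ a).
Proof.
  intros Hh Ha. unfold bose. rewrite <- exp_INR_mult, <- Ropp_mult_distr_r, exp_Ropp.
  assert (H := exp_INR_mult_gt_1 a h Ha Hh). field. lra.
Qed.

Lemma bose_bounds (a : nat) (d h : R) :
  0 < d <= h -> 0 <= bose a h <= exp (- h) ^ a / (1 - exp (- d)).
Proof.
  intros Hd. destruct (exp_neg_bounds d ltac:(lra)) as [_ Hd1].
  destruct (exp_neg_bounds h ltac:(lra)) as [Hw0 Hw1].
  assert (Hle : exp (- h) <= exp (- d)).
  { destruct (proj2 Hd) as [H|H]; [left; apply exp_increasing; lra | rewrite H; lra]. }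
  destruct a as [|a].
  - rewrite bose_0. split; [lra|]. simpl. left; apply Rdiv_lt_0_compat; lra.
  - rewrite bose_geom by (lia || lra).
    assert (Hpow : exp (- h) ^ S a <= exp (- h)).
    { simpl. assert (exp (- h) ^ a <= 1) by (rewrite <- (pow1 a); apply pow_incr; lra). nra. }
    assert (Hpos : 0 < exp (- h) ^ S a) by (apply pow_lt; auto).
    split; [left; apply Rdiv_lt_0_compat; lra|].
    apply Rmult_le_compat_l; [lra|]. apply Rinv_le_contravar; lra.
Qed.

Lemma lambert_term_bounds (e i a : nat) (d h : R) :
  0 < d <= h -> (0 < e)%nat ->
  0 <= INR a ^ i * bose a h ^ e <= (/ (1 - exp (- d))) ^ e * (INR a ^ i * exp (- h) ^ a).
Proof.
  intros Hd He. assert (Hi : 0 <= INR a ^ i) by apply pow_le, pos_INR.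
  destruct (bose_bounds a d h Hd) as [Hb0 Hb1].
  destruct (exp_neg_bounds h ltac:(lra)) as [Hw0 Hw1].
  destruct (exp_neg_bounds d ltac:(lra)) as [_ Hd1].
  assert (Hc : 0 < / (1 - exp (- d))) by (apply Rinv_0_lt_compat; lra).
  unfold Rdiv in Hb1. set (c := / (1 - exp (- d))) in *. set (w := exp (- h) ^ a) in *.
  assert (Hw : 0 < w <= 1).
  { split; [apply pow_lt; auto | rewrite <- (pow1 a); apply pow_incr; lra]. }
  assert (Hwe : w ^ e <= w).
  { destruct e as [|e]; [lia|]. simpl.
    assert (w ^ e <= 1) by (rewrite <- (pow1 e); apply pow_incr; lra). nra. }
  split; [apply Rmult_le_pos; auto; apply pow_le; auto|].
  replace (c ^ e * (INR a ^ i * w)) with (INR a ^ i * (c ^ e * w)) by ring.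
  apply Rmult_le_compat_l; auto.
  apply Rle_trans with ((w * c) ^ e); [apply pow_incr; auto|].
  rewrite Rpow_mult_distr, Rmult_comm. apply Rmult_le_compat_l; auto. apply pow_le; lra.
Qed.

Lemma ex_series_INR_pow_exp (C : R) (i : nat) (d : R) :
  0 < d -> ex_series (fun a => C * (INR a ^ i * exp (- d) ^ a)).
Proof.
  intros Hd. apply (ex_series_scal_l (V := R_NormedModule) C).
  apply ex_series_INR_pow_geom. destruct (exp_neg_bounds d Hd). rewrite Rabs_pos_eq; lra.
Qed.

Lemma is_series_lambert (e i : nat) (h : R) :
  0 < h -> (0 < e)%nat -> is_series (fun a => INR a ^ i * bose a h ^ e) (lambert e i h).
Proof.
  intros Hh He. apply Series_correct.
  apply (ex_series_Rabs_le _ _) with (2 := ex_series_INR_pow_exp ((/ (1 - exp (- h))) ^ e) i h Hh).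
  intros a. destruct (lambert_term_bounds e i a h h ltac:(lra) He).
  rewrite Rabs_pos_eq; auto.
Qed.

Lemma lambert_ge_0 (e i : nat) (h : R) : 0 < h -> (0 < e)%nat -> 0 <= lambert e i h.
Proof.
  intros Hh He. rewrite <- (is_series_unique (fun _ => 0) 0).
  - apply Series_le; [|eexists; apply is_series_lambert; auto].
    intros a; split; [lra|]. apply (lambert_term_bounds e i a h h ltac:(lra) He).
  - exact (is_series_zero (V := R_NormedModule)).
Qed.

Lemma is_derive_bose (a : nat) (h : R) :
  0 < h -> is_derive (bose a) h (- (INR a * (bose a h + bose a h ^ 2))).
Proof.
  intros Hh. destruct a as [|a].
  - apply is_derive_ext with (fun _ => 0); [intros; symmetry; apply bose_0|].
    replace (- (INR 0 * (bose 0 h + bose 0 h ^ 2))) with 0 by (simpl; ring).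
    apply (is_derive_const (K := R_AbsRing) (V := R_NormedModule)).
  - assert (H := exp_INR_mult_gt_1 (S a) h (Nat.lt_0_succ a) Hh).
    unfold bose. set (c := INR (S a)) in *. auto_derive; [lra|]. field. lra.
Qed.

Lemma is_derive_lambert_term (e i a : nat) (h : R) :
  0 < h -> (0 < e)%nat ->
  is_derive (fun t => INR a ^ i * bose a t ^ e) h
    (- INR e * (INR a ^ S i * bose a h ^ e + INR a ^ S i * bose a h ^ S e)).
Proof.
  intros Hh He. destruct e as [|e]; [lia|].
  assert (D := is_derive_scal _ h (INR a ^ i) _
    (is_derive_pow (bose a) (S e) h _ (is_derive_bose a h Hh))).
  simpl pred in D.
  replace (- INR (S e) * _) with
    (INR a ^ i * (INR (S e) * - (INR a * (bose a h + bose a h ^ 2)) * bose a h ^ e))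
    by (simpl; ring).
  exact D.
Qed.

Lemma is_derive_lambert (e i : nat) (h : R) :
  0 < h -> (0 < e)%nat ->
  is_derive (lambert e i) h (- INR e * (lambert e (S i) h + lambert (S e) (S i) h)).
Proof.
  intros Hh He. set (d := h / 2). assert (Hd : 0 < d) by (unfold d; lra).
  assert (Hball : forall y, Rabs (y - h) < d -> 0 < d <= y).
  { intros y Hy. apply Rabs_def2 in Hy. unfold d in *; lra. }
  set (df a y := - INR e * (INR a ^ S i * bose a y ^ e + INR a ^ S i * bose a y ^ S e)).
  replace (- INR e * _) with (Series (fun a => df a h)).
  2:{ apply is_series_unique. apply (is_series_scal_l (V := R_NormedModule) (- INR e)).
      apply (is_series_plus (V := R_NormedModule)); apply is_series_lambert; auto. }
  set (c := / (1 - exp (- d))).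
  apply (is_derive_Series_dominated (fun a y => INR a ^ i * bose a y ^ e) df
    (fun a => INR e * (c ^ e + c ^ S e) * (INR a ^ S i * exp (- d) ^ a)) h d); auto.
  - apply ex_series_INR_pow_exp; auto.
  - intros y Hy. eexists. apply is_series_lambert; auto. specialize (Hball y Hy); lra.
  - intros a y Hy. apply is_derive_lambert_term; auto. specialize (Hball y Hy); lra.
  - intros a y Hy. specialize (Hball y Hy). unfold df.
    destruct (lambert_term_bounds e (S i) a d y Hball He) as [B0 B1].
    destruct (lambert_term_bounds (S e) (S i) a d y Hball ltac:(lia)) as [B2 B3].
    fold c in B1, B3. assert (Hexp : exp (- y) ^ a <= exp (- d) ^ a).
    { apply pow_incr; split; [left; apply exp_pos|].
      destruct (proj2 Hball) as [H|H]; [left; apply exp_increasing | rewrite H]; lra. }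
    assert (Hc : 0 < c).
    { apply Rinv_0_lt_compat. destruct (exp_neg_bounds d Hd); lra. }
    assert (Hi : 0 <= INR a ^ S i) by apply pow_le, pos_INR.
    assert (Hmono : INR a ^ S i * exp (- y) ^ a <= INR a ^ S i * exp (- d) ^ a)
      by (apply Rmult_le_compat_l; auto).
    assert (Hce := pow_lt c e Hc). assert (HcSe := pow_lt c (S e) Hc).
    rewrite Rabs_mult, Rabs_Ropp, !Rabs_pos_eq, Rmult_assoc by (try apply pos_INR; lra).
    apply Rmult_le_compat_l; [apply pos_INR | nra].
Qed.

Lemma lambert_term_decay (e i a : nat) (h : R) :
  1 <= h -> (0 < e)%nat ->
  0 <= INR a ^ i * bose a h ^ e
    <= exp (- h + 1) * ((/ (1 - exp (- (1)))) ^ e * (INR a ^ i * exp (- (1)) ^ a)).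
Proof.
  intros Hh He. destruct (lambert_term_bounds e i a 1 h ltac:(lra) He) as [B0 B1].
  split; [exact B0|].
  destruct (exp_neg_bounds 1 Rlt_0_1) as [E0 E1].
  assert (Hc : 0 < (/ (1 - exp (- (1)))) ^ e) by (apply pow_lt, Rinv_0_lt_compat; lra).
  assert (Hi : 0 <= INR a ^ i) by apply pow_le, pos_INR.
  destruct a as [|a].
  - rewrite bose_0, (pow_i e), Rmult_0_r by lia. assert (P := exp_pos (- h + 1)).
    apply Rmult_le_pos; [lra|]. apply Rmult_le_pos; [lra|].
    apply Rmult_le_pos; [auto | apply pow_le; lra].
  - eapply Rle_trans; [exact B1|].
    replace (exp (- h + 1) * _) with
      ((/ (1 - exp (- (1)))) ^ e * (INR (S a) ^ i * (exp (- h + 1) * exp (- (1)) ^ S a))) by ring.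
    apply Rmult_le_compat_l; [lra|]. apply Rmult_le_compat_l; auto.
    rewrite <- !exp_INR_mult, <- exp_plus.
    assert (Hexp : INR (S a) * - h <= - h + 1 + INR (S a) * - (1)).
    { rewrite S_INR. assert (K := pos_INR a). nra. }
    destruct Hexp as [H|H]; [left; apply exp_increasing; exact H | rewrite H; apply Rle_refl].
Qed.

Lemma is_lim_lambert (e i : nat) : (0 < e)%nat -> is_lim (lambert e i) p_infty 0.
Proof.
  intros He.
  set (b a := (/ (1 - exp (- (1)))) ^ e * (INR a ^ i * exp (- (1)) ^ a)).
  apply (is_lim_le_le_loc (fun _ => 0) (fun h => exp (- h + 1) * Series b)).
  - exists 1; intros h Hh. split; [apply lambert_ge_0; auto; lra|].
    rewrite <- Series_scal_l. apply Series_le; [intros a; apply lambert_term_decay; auto; lra|].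
    apply (ex_series_scal_l (V := R_NormedModule) (exp (- h + 1))), ex_series_INR_pow_exp; lra.
  - apply is_lim_const.
  - replace (Finite 0) with (Rbar_mult 0 (Series b)) by (simpl; f_equal; ring).
    apply is_lim_scal_r.
    apply is_lim_ext with (fun h => exp (-1 * h + 1)); [intros h; f_equal; ring|].
    apply (is_lim_comp_lin exp (-1) 1 p_infty); [|lra].
    replace (Rbar_plus (Rbar_mult (-1) p_infty) 1) with m_infty; [apply is_lim_exp_m|].
    simpl. destruct Rle_dec; [exfalso; lra | reflexivity].
Qed.

Lemma is_series_bose (a : nat) (h : R) :
  0 < h -> (0 < a)%nat -> is_series (fun m => exp (- (INR (S m) * h)) ^ a) (bose a h).
Proof.
  intros Hh Ha. rewrite bose_geom by auto. set (w := exp (- h) ^ a).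
  destruct (exp_neg_bounds h Hh) as [E0 E1].
  assert (Hw : 0 <= w < 1) by (apply pow_lt_1_compat; auto; lra).
  apply is_series_ext with (fun m => w * w ^ m).
  - intros m. rewrite Ropp_mult_distr_r, exp_INR_mult, <- pow_mult, Nat.mul_comm, pow_mult.
    reflexivity.
  - apply (is_series_scal_l (V := R_NormedModule) w), is_series_geom. rewrite Rabs_pos_eq; lra.
Qed.

Lemma is_series_lambert_rows (i : nat) (G : R -> R) (h : R) :
  0 < h ->
  (forall w, Rabs w < 1 -> is_series (fun n => INR n ^ S i * w ^ n) (G w)) ->
  is_series (fun m => G (exp (- (INR (S m) * h)))) (lambert 1 (S i) h).
Proof.
  intros Hh HG.
  apply (is_series_Tonelli (fun m n => INR n ^ S i * exp (- (INR (S m) * h)) ^ n) _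
    (fun n => INR n ^ S i * bose n h ^ 1)).
  - intros m n. apply Rmult_le_pos; apply pow_le; [apply pos_INR | left; apply exp_pos].
  - intros m. apply HG. destruct (exp_neg_bounds (INR (S m) * h)).
    + apply Rmult_lt_0_compat; [apply lt_0_INR; lia | exact Hh].
    + rewrite Rabs_pos_eq; lra.
  - intros [|n].
    + apply is_series_ext with (fun _ => 0); [intros m; simpl; ring|].
      replace (INR 0 ^ S i * bose 0 h ^ 1) with 0 by (simpl; ring).
      exact (is_series_zero (V := R_NormedModule)).
    + apply (is_series_scal_l (V := R_NormedModule) (INR (S n) ^ S i)).
      rewrite pow_1. apply is_series_bose; auto; lia.
  - apply is_series_lambert; auto.
Qed.

(** * Ramanujan's differential equations *)

Lemma sum_f_R0_interior_eq (f g : nat -> R) (d : nat) :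
  (0 < d)%nat -> (forall a, (0 < a < d)%nat -> f a = g a) ->
  sum_f_R0 f d - f 0%nat - f d = sum_f_R0 g d - g 0%nat - g d.
Proof.
  intros Hd H. destruct d as [|[|d]]; [lia | simpl; ring |].
  rewrite (tech5 f), (tech5 g), !(decomp_sum _ (S d)) by lia. simpl pred.
  rewrite (sum_eq (fun i => f (S i)) (fun i => g (S i))) by (intros; apply H; lia). ring.
Qed.

Definition triangle_sum (l : nat -> R) (s : R -> R -> R) (N : nat) : R :=
  sum_f_R0 (fun d =>
    sum_f_R0 (fun a => s (INR a) (INR (d - a)) * (l a * l (d - a)%nat)) d) N.

Definition square_sum (l : nat -> R) (s : R -> R -> R) (N : nat) : R :=
  sum_f_R0 (fun d => sum_f_R0 (fun a => s (INR a) (INR d) * (l a * l d)) N) N.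

Section PairSums.
Variables (l : nat -> R) (s s' : R -> R -> R).
Hypothesis l_0 : l 0%nat = 0.
Hypothesis l_mult : forall a b,
  (0 < a)%nat -> (0 < b)%nat -> l a * l b = l (a + b)%nat * (1 + l a + l b).
Hypothesis s_sym : forall x y, s x y = s y x.
Hypothesis s'_sym : forall x y, s' x y = s' y x.
Hypothesis s_s' : forall x y, s x (y - x) = s' x y.

Lemma square_sum_S (d : nat) :
  square_sum l s' (S d) =
  square_sum l s' d + 2 * (l (S d) * sum_f_R0 (fun a => s' (INR a) (INR (S d)) * l a) (S d))
  - s' (INR (S d)) (INR (S d)) * l (S d) ^ 2.
Proof.
  unfold square_sum. rewrite tech5.
  rewrite (sum_eq _ (fun i => sum_f_R0 (fun a => s' (INR a) (INR i) * (l a * l i)) d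
    + s' (INR i) (INR (S d)) * l i * l (S d))) by (intros; rewrite tech5, s'_sym; ring).
  rewrite sum_plus, <- scal_sum.
  rewrite (sum_eq (fun a => s' (INR a) (INR (S d)) * (l a * l (S d)))
    (fun a => s' (INR a) (INR (S d)) * l a * l (S d))) by (intros; ring).
  rewrite <- scal_sum, !tech5. ring.
Qed.

(* The addition rule turns each product on the antidiagonal [a + b = d] into products with
   [l d], which are the new entries of the square of side [d]. *)
Lemma antidiagonal_sum (d : nat) :
  sum_f_R0 (fun a => s (INR a) (INR (d - a)) * (l a * l (d - a)%nat)) d =
  l d * (sum_f_R0 (fun a => s (INR a) (INR d - INR a)) d - 2 * s 0 (INR d))
  + 2 * (l d * sum_f_R0 (fun a => s' (INR a) (INR d) * l a) d)
  - 2 * (s' (INR d) (INR d) * l d ^ 2).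
Proof.
  destruct (Nat.eq_dec d 0) as [->|Hd]; [simpl; rewrite l_0; ring|].
  assert (E := sum_f_R0_interior_eq
    (fun a => s (INR a) (INR (d - a)) * (l a * l (d - a)%nat))
    (fun a => s (INR a) (INR d - INR a) * l d + (s' (INR a) (INR d) * l a * l d
       + s' (INR (d - a)) (INR d) * l (d - a)%nat * l d)) d ltac:(lia)).
  simpl in E. rewrite !sum_plus, <- !scal_sum in E.
  rewrite (sum_f_R0_skip (fun a => s' (INR a) (INR d) * l a)) in E.
  rewrite Nat.sub_0_r, Nat.sub_diag, l_0, Rminus_0_r, Rminus_eq_0, (s_sym (INR d) 0) in E.
  replace (s' (INR d) (INR d)) with (s 0 (INR d)) in *
    by (rewrite <- s_s', Rminus_eq_0; apply s_sym).
  rewrite <- (Rplus_0_r (sum_f_R0 _ d)).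
  transitivity (sum_f_R0 (fun a => s (INR a) (INR (d - a)) * (l a * l (d - a)%nat)) d
    - s 0 (INR d) * (0 * l d) - s (INR d) 0 * (l d * 0)); [ring|].
  change (INR 0) with 0 in E. rewrite E; [ring|].
  intros a Ha. rewrite l_mult by lia. replace (a + (d - a))%nat with d by lia.
  rewrite <- !s_s', minus_INR by lia.
  replace (INR d - (INR d - INR a)) with (INR a) by ring.
  rewrite (s_sym (INR d - INR a)). ring.
Qed.

Lemma triangle_sum_minus_square_sum (N : nat) :
  triangle_sum l s N - square_sum l s' N =
  sum_f_R0 (fun d => l d * (sum_f_R0 (fun a => s (INR a) (INR d - INR a)) d - 2 * s 0 (INR d))
                     - s' (INR d) (INR d) * l d ^ 2) N.
Proof.
  induction N as [|N IH].
  - unfold triangle_sum, square_sum; simpl; rewrite l_0; ring.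
  - rewrite tech5, <- IH, square_sum_S. unfold triangle_sum. rewrite tech5, antidiagonal_sum.
    ring.
Qed.

End PairSums.

Definition binary_form (c : nat -> R) (n : nat) (x y : R) : R :=
  sum_f_R0 (fun i => c i * x ^ i * y ^ (n - i)) n.

Lemma triangle_sum_plus (l : nat -> R) (s t : R -> R -> R) (N : nat) :
  triangle_sum l (fun x y => s x y + t x y) N = triangle_sum l s N + triangle_sum l t N.
Proof.
  unfold triangle_sum. rewrite <- sum_plus. apply sum_eq; intros d _.
  rewrite <- sum_plus. apply sum_eq; intros; ring.
Qed.

Lemma square_sum_plus (l : nat -> R) (s t : R -> R -> R) (N : nat) :
  square_sum l (fun x y => s x y + t x y) N = square_sum l s N + square_sum l t N.
Proof.
  unfold square_sum. rewrite <- sum_plus. apply sum_eq; intros d _.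
  rewrite <- sum_plus. apply sum_eq; intros; ring.
Qed.

Lemma is_lim_seq_triangle_sum_monomial (c : R) (i j : nat) (h : R) :
  0 < h ->
  is_lim_seq (triangle_sum (fun a => bose a h) (fun x y => c * x ^ i * y ^ j))
    (c * (lambert 1 i h * lambert 1 j h)).
Proof.
  intros Hh. apply is_series_sum_f_R0.
  assert (Hpos : forall i a, 0 <= INR a ^ i * bose a h ^ 1).
  { intros k a. apply (lambert_term_bounds 1 k a h h ltac:(lra) Nat.lt_0_1). }
  apply is_series_ext with (2 := is_series_scal_l (V := R_NormedModule) c _ _
    (is_series_mult_pos _ _ _ _ (is_series_lambert 1 i h Hh Nat.lt_0_1)
       (is_series_lambert 1 j h Hh Nat.lt_0_1) (Hpos i) (Hpos j))).
  intros d. unfold scal; simpl; unfold mult; simpl. rewrite scal_sum.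
  apply sum_eq; intros; ring.
Qed.

Lemma is_lim_seq_square_sum_monomial (c : R) (i j : nat) (h : R) :
  0 < h ->
  is_lim_seq (square_sum (fun a => bose a h) (fun x y => c * x ^ i * y ^ j))
    (c * (lambert 1 i h * lambert 1 j h)).
Proof.
  intros Hh.
  assert (L : forall k, is_lim_seq (sum_f_R0 (fun a => INR a ^ k * bose a h ^ 1)) (lambert 1 k h)).
  { intros k. apply is_series_sum_f_R0, is_series_lambert; auto. }
  apply is_lim_seq_ext with (2 := is_lim_seq_mult' _ _ _ _ (is_lim_seq_const c)
    (is_lim_seq_mult' _ _ _ _ (L i) (L j))).
  intros N. unfold square_sum. rewrite scal_sum, scal_sum. apply sum_eq; intros d _.
  rewrite (Rmult_comm _ (sum_f_R0 _ _)), Rmult_assoc, Rmult_comm, scal_sum.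
  apply sum_eq; intros; ring.
Qed.

Lemma is_lim_seq_binary_form
  (F : (R -> R -> R) -> nat -> R) (c : nat -> R) (n : nat) (M : nat -> R) :
  (forall s t N, F (fun x y => s x y + t x y) N = F s N + F t N) ->
  (forall c i j, is_lim_seq (F (fun x y => c * x ^ i * y ^ j)) (c * (M i * M j))) ->
  is_lim_seq (F (binary_form c n)) (sum_f_R0 (fun i => c i * (M i * M (n - i)%nat)) n).
Proof.
  intros Fplus Fmonomial. unfold binary_form. generalize n at 1 3 as m; intros m.
  induction n as [|n IH]; [apply Fmonomial|].
  simpl sum_f_R0. apply is_lim_seq_ext with
    (2 := is_lim_seq_plus' _ _ _ _ IH (Fmonomial (c (S n)) (S n) (m - S n)%nat)).
  intros N. symmetry; apply Fplus.
Qed.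

Lemma is_series_polynomial_bose (g : nat -> R) (m : nat) (h : R) :
  0 < h ->
  is_series (fun d => bose d h * sum_f_R0 (fun j => g j * INR d ^ j) m)
    (sum_f_R0 (fun j => g j * lambert 1 j h) m).
Proof.
  intros Hh.
  assert (H := is_series_sum_n (V := R_NormedModule) _ _ m (fun j =>
    is_series_scal_l (V := R_NormedModule) (g j) _ _ (is_series_lambert 1 j h Hh Nat.lt_0_1))).
  rewrite sum_n_Reals in H. apply is_series_ext with (2 := H).
  intros d. rewrite sum_n_Reals, scal_sum. apply sum_eq; intros.
  unfold scal; simpl; unfold mult; simpl. ring.
Qed.

Lemma lambert_quadratic_relation (c g : nat -> R) (n m : nat) (h : R) :
  let s := binary_form c n in
  0 < h ->
  (forall x y, s x y = s y x) -> (forall x y, s (- x) y = s (- y) x) ->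
  (forall x y, s x (y - x) = s (- x) y) -> (forall x, s (- x) x = x ^ n) ->
  (forall d, sum_f_R0 (fun a => s (INR a) (INR d - INR a)) d - 2 * s 0 (INR d)
             = sum_f_R0 (fun j => g j * INR d ^ j) m) ->
  sum_f_R0 (fun i => c i * (1 - (-1) ^ i) * (lambert 1 i h * lambert 1 (n - i) h)) n
  = sum_f_R0 (fun j => g j * lambert 1 j h) m - lambert 2 n h.
Proof.
  intros s Hh s_sym s'_sym s_s' s_diag Hconv.
  set (l a := bose a h). set (s' := binary_form (fun i => (-1) ^ i * c i) n).
  assert (Es' : forall x y, s (- x) y = s' x y).
  { intros x y. apply sum_eq; intros i _. replace (- x) with (-1 * x) by ring.
    rewrite Rpow_mult_distr; ring. }
  assert (Ltri := is_lim_seq_binary_form (triangle_sum l) c n (fun i => lambert 1 i h)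
    (triangle_sum_plus l) (fun c i j => is_lim_seq_triangle_sum_monomial c i j h Hh)).
  assert (Lsq := is_lim_seq_binary_form (square_sum l) (fun i => (-1) ^ i * c i) n
    (fun i => lambert 1 i h) (square_sum_plus l)
    (fun c i j => is_lim_seq_square_sum_monomial c i j h Hh)).
  assert (Lval : is_lim_seq
    (sum_f_R0 (fun d => l d * sum_f_R0 (fun j => g j * INR d ^ j) m - INR d ^ n * l d ^ 2))
    (sum_f_R0 (fun j => g j * lambert 1 j h) m - lambert 2 n h)).
  { apply is_series_sum_f_R0. exact (is_series_minus _ _ _ _
      (is_series_polynomial_bose g m h Hh) (is_series_lambert 2 n h Hh Nat.lt_0_2)). }
  assert (Ldiff := is_lim_seq_minus' _ _ _ _ Ltri Lsq).
  rewrite <- minus_sum in Ldiff.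
  rewrite (sum_eq _ (fun i => c i * (lambert 1 i h * lambert 1 (n - i) h)
    - (-1) ^ i * c i * (lambert 1 i h * lambert 1 (n - i) h))) by (intros; ring).
  apply Rbar_finite_eq. rewrite <- (is_lim_seq_unique _ _ Ldiff).
  rewrite <- (is_lim_seq_unique _ _ Lval). apply Lim_seq_ext; intros N.
  unfold s in *.
  rewrite (triangle_sum_minus_square_sum l (binary_form c n) s').
  - apply sum_eq; intros d _. rewrite Hconv, <- Es', s_diag.
    ring.
  - apply bose_0.
  - intros; apply bose_mult; auto.
  - exact s_sym.
  - intros x y. rewrite <- !Es'; auto.
  - intros x y. rewrite s_s'; auto.
Qed.

Lemma sum_complement_product (d : nat) :
  sum_f_R0 (fun a => INR a * (INR d - INR a)) d = (INR d ^ 3 - INR d) / 6.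
Proof.
  assert (G : forall x n, sum_f_R0 (fun a => INR a * (x - INR a)) n
    = INR n * (INR n + 1) * (x / 2 - (2 * INR n + 1) / 6)).
  { intros x n; induction n as [|n IH]; [simpl; field|].
    rewrite tech5, IH, S_INR; field. }
  rewrite G; field.
Qed.

Lemma sum_complement_product_sq (d : nat) :
  sum_f_R0 (fun a => (INR a * (INR d - INR a)) ^ 2) d = (INR d ^ 5 - INR d) / 30.
Proof.
  assert (G : forall x n, sum_f_R0 (fun a => (INR a * (x - INR a)) ^ 2) n
    = INR n * (INR n + 1) * (x ^ 2 * (2 * INR n + 1) / 6 - x * INR n * (INR n + 1) / 2
        + (2 * INR n + 1) * (3 * INR n ^ 2 + 3 * INR n - 1) / 30)).
  { intros x n; induction n as [|n IH]; [simpl; field|].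
    rewrite tech5, IH, S_INR; field. }
  rewrite G; field.
Qed.

Lemma sum_complement_product_cube (d : nat) :
  sum_f_R0 (fun a => (INR a * (INR d - INR a)) ^ 3) d
  = (3 * INR d ^ 7 + 7 * INR d ^ 3 - 10 * INR d) / 420.
Proof.
  assert (G : forall x n, sum_f_R0 (fun a => (INR a * (x - INR a)) ^ 3) n
    = INR n * (INR n + 1) * (x ^ 3 * INR n * (INR n + 1) / 4
        - x ^ 2 * (2 * INR n + 1) * (3 * INR n ^ 2 + 3 * INR n - 1) / 10
        + x * INR n * (INR n + 1) * (2 * INR n ^ 2 + 2 * INR n - 1) / 4
        - (2 * INR n + 1) * (3 * INR n ^ 4 + 6 * INR n ^ 3 - 3 * INR n + 1) / 42)).
  { intros x n; induction n as [|n IH]; [simpl; field|].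
    rewrite tech5, IH, S_INR; field. }
  rewrite G; field.
Qed.

(* A symmetric form is a polynomial in [x + y] and [x y], hence in [x y] alone on [x + y = d]. *)
Lemma sum_polynomial_complement_product (d : nat) (u0 u1 u2 u3 : R) :
  sum_f_R0 (fun a => let p := INR a * (INR d - INR a) in
    u0 + u1 * p + u2 * p ^ 2 + u3 * p ^ 3) d
  = u0 * (INR d + 1) + u1 * ((INR d ^ 3 - INR d) / 6) + u2 * ((INR d ^ 5 - INR d) / 30)
    + u3 * ((3 * INR d ^ 7 + 7 * INR d ^ 3 - 10 * INR d) / 420).
Proof.
  rewrite <- sum_complement_product, <- sum_complement_product_sq, <- sum_complement_product_cube.
  rewrite <- S_INR, <- sum_cte, !scal_sum, <- !sum_plus. apply sum_eq; intros; cbv zeta; ring.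
Qed.

Lemma lambert_1_1_sq (h : R) : 0 < h ->
  2 * lambert 1 1 h ^ 2
  = 5 / 6 * lambert 1 3 h - lambert 1 2 h + 1 / 6 * lambert 1 1 h - lambert 2 2 h.
Proof.
  intros Hh.
  assert (E := lambert_quadratic_relation (fun i => nth i [1; 1; 1] 0)
    (fun j => nth j [0; 1 / 6; -1; 5 / 6] 0) 2 3 h).
  etransitivity; [|etransitivity; [apply E|]]; auto;
    try (intros; unfold binary_form; simpl; field).
  intros d. rewrite (sum_eq _ (fun a => let p := INR a * (INR d - INR a) in
    INR d ^ 2 + -1 * p + 0 * p ^ 2 + 0 * p ^ 3)).
  - rewrite sum_polynomial_complement_product. unfold binary_form; simpl; field.
  - intros a _. unfold binary_form; simpl; ring.
Qed.

Lemma lambert_1_1_mult_1_3 (h : R) : 0 < h ->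
  8 * lambert 1 1 h * lambert 1 3 h
  = 7 / 10 * lambert 1 5 h - lambert 1 4 h + 1 / 3 * lambert 1 3 h - 1 / 30 * lambert 1 1 h
    - lambert 2 4 h.
Proof.
  intros Hh.
  assert (E := lambert_quadratic_relation (fun i => nth i [1; 2; 3; 2; 1] 0)
    (fun j => nth j [0; - 1 / 30; 0; 1 / 3; -1; 7 / 10] 0) 4 5 h).
  etransitivity; [|etransitivity; [apply E|]]; auto;
    try (intros; unfold binary_form; simpl; field).
  intros d. rewrite (sum_eq _ (fun a => let p := INR a * (INR d - INR a) in
    INR d ^ 4 + (-2 * INR d ^ 2) * p + 1 * p ^ 2 + 0 * p ^ 3)).
  - rewrite sum_polynomial_complement_product. unfold binary_form; simpl; field.
  - intros a _. unfold binary_form; simpl; ring.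
Qed.

(* The form is [(x^2 + x y + y^2)^3 - 249/14 (x y (x + y))^2]: the second coefficient is the
   one that cancels the seventh powers in the divisor sum. *)
Lemma lambert_1_1_mult_1_5 (h : R) : 0 < h ->
  12 * lambert 1 1 h * lambert 1 5 h - 400 / 7 * lambert 1 3 h ^ 2
  = - lambert 1 6 h + 1 / 2 * lambert 1 5 h + 10 / 21 * lambert 1 3 h + 1 / 42 * lambert 1 1 h
    - lambert 2 6 h.
Proof.
  intros Hh.
  assert (E := lambert_quadratic_relation
    (fun i => nth i [1; 3; - 165 / 14; - 200 / 7; - 165 / 14; 3; 1] 0)
    (fun j => nth j [0; 1 / 42; 0; 10 / 21; 0; 1 / 2; -1] 0) 6 6 h).
  etransitivity; [|etransitivity; [apply E|]]; auto;
    try (intros; unfold binary_form; simpl; field).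
  intros d. rewrite (sum_eq _ (fun a => let p := INR a * (INR d - INR a) in
    INR d ^ 6 + (-3 * INR d ^ 4) * p + (3 - 249 / 14) * INR d ^ 2 * p ^ 2 + (-1) * p ^ 3)).
  - rewrite sum_polynomial_complement_product. unfold binary_form; simpl; field.
  - intros a _. unfold binary_form; simpl; field.
Qed.

Definition eisE2 (h : R) : R := 1 - 24 * lambert 1 1 h.
Definition eisE4 (h : R) : R := 1 + 240 * lambert 1 3 h.
Definition eisE6 (h : R) : R := 1 - 504 * lambert 1 5 h.

Lemma is_derive_affine_lambert (u c : R) (i : nat) (h : R) :
  0 < h ->
  is_derive (fun t => u + c * lambert 1 i t) h (- c * (lambert 1 (S i) h + lambert 2 (S i) h)).
Proof.
  intros Hh. assert (D := is_derive_lambert 1 i h Hh Nat.lt_0_1).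
  replace (- c * (lambert 1 (S i) h + lambert 2 (S i) h)) with
    (plus 0 (c * (- INR 1 * (lambert 1 (S i) h + lambert 2 (S i) h))))
    by (unfold plus; simpl; ring).
  apply (is_derive_plus (K := R_AbsRing) (V := R_NormedModule) (fun _ => u)).
  - apply (is_derive_const (K := R_AbsRing) (V := R_NormedModule)).
  - apply (is_derive_scal (lambert 1 i)); exact D.
Qed.

Lemma is_derive_eisE2 (h : R) : 0 < h -> is_derive eisE2 h (- (eisE2 h ^ 2 - eisE4 h) / 12).
Proof.
  intros Hh. apply is_derive_ext with (fun t => 1 + -24 * lambert 1 1 t).
  { intros t; unfold eisE2; simpl; ring. }
  replace (- (eisE2 h ^ 2 - eisE4 h) / 12) with (- -24 * (lambert 1 2 h + lambert 2 2 h)).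
  - apply is_derive_affine_lambert; auto.
  - assert (E := lambert_1_1_sq h Hh). unfold eisE2, eisE4. lra.
Qed.

Lemma is_derive_eisE4 (h : R) : 0 < h -> is_derive eisE4 h (- (eisE2 h * eisE4 h - eisE6 h) / 3).
Proof.
  intros Hh.
  replace (- (eisE2 h * eisE4 h - eisE6 h) / 3) with (- 240 * (lambert 1 4 h + lambert 2 4 h)).
  - apply is_derive_affine_lambert; auto.
  - assert (E := lambert_1_1_mult_1_3 h Hh). unfold eisE2, eisE4, eisE6. lra.
Qed.

Lemma is_derive_eisE6 (h : R) :
  0 < h -> is_derive eisE6 h (- (eisE2 h * eisE6 h - eisE4 h ^ 2) / 2).
Proof.
  intros Hh. apply is_derive_ext with (fun t => 1 + -504 * lambert 1 5 t).
  { intros t; unfold eisE6; simpl; ring. }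
  replace (- (eisE2 h * eisE6 h - eisE4 h ^ 2) / 2) with (- -504 * (lambert 1 6 h + lambert 2 6 h)).
  - apply is_derive_affine_lambert; auto.
  - assert (E := lambert_1_1_mult_1_5 h Hh). unfold eisE2, eisE4, eisE6. lra.
Qed.

Lemma is_lim_affine_lambert (u c : R) (i : nat) :
  is_lim (fun h => u + c * lambert 1 i h) p_infty u.
Proof.
  replace (Finite u) with (Rbar_plus u (Rbar_mult c 0)) by (simpl; f_equal; ring).
  apply is_lim_plus'; [apply is_lim_const|].
  apply (is_lim_scal_l (lambert 1 i) c p_infty 0), is_lim_lambert; auto.
Qed.

Lemma is_lim_eisE2 : is_lim eisE2 p_infty 1.
Proof.
  apply is_lim_ext with (2 := is_lim_affine_lambert 1 (-24) 1). intros h; unfold eisE2; ring.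
Qed.

Lemma is_lim_eisE4 : is_lim eisE4 p_infty 1.
Proof. exact (is_lim_affine_lambert 1 240 3). Qed.

Lemma is_lim_eisE6 : is_lim eisE6 p_infty 1.
Proof.
  apply is_lim_ext with (2 := is_lim_affine_lambert 1 (-504) 5). intros h; unfold eisE6; ring.
Qed.

Lemma eisE4_pos (h : R) : 0 < h -> 0 < eisE4 h.
Proof. intros Hh. unfold eisE4. assert (K := lambert_ge_0 1 3 h Hh Nat.lt_0_1). lra. Qed.

(** * Complex limits and the complex sine *)

Lemma filterlim_C {T : Type} {F : (T -> Prop) -> Prop} {FF : Filter F} (f : T -> C) (z : C) :
  filterlim f F (locally z) <->
  filterlim (fun x => Re (f x)) F (locally (Re z)) /\
  filterlim (fun x => Im (f x)) F (locally (Im z)).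
Proof.
  rewrite !filterlim_locally. split.
  - intros H; split; intros eps; generalize (H eps); apply filter_imp; intros x [H1 H2]; auto.
  - intros [H1 H2] eps. generalize (filter_and _ _ (H1 eps) (H2 eps)).
    apply filter_imp; intros x [B1 B2]; split; auto.
Qed.

Section FilterlimC.
Context {T : Type} {F : (T -> Prop) -> Prop} {FF : Filter F}.

Lemma filterlim_Rplus (f g : T -> R) (a b : R) :
  filterlim f F (locally a) -> filterlim g F (locally b) ->
  filterlim (fun x => f x + g x) F (locally (a + b)).
Proof.
  intros Hf Hg. exact (filterlim_comp_2 _ _ _ Hf Hg (filterlim_plus (V := R_NormedModule) a b)).
Qed.

Lemma filterlim_Rmult (f g : T -> R) (a b : R) :
  filterlim f F (locally a) -> filterlim g F (locally b) ->
  filterlim (fun x => f x * g x) F (locally (a * b)).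
Proof.
  intros Hf Hg. exact (filterlim_comp_2 _ _ _ Hf Hg (filterlim_mult (K := R_AbsRing) a b)).
Qed.

Lemma filterlim_Cplus (f g : T -> C) (a b : C) :
  filterlim f F (locally a) -> filterlim g F (locally b) ->
  filterlim (fun x => f x + g x)%C F (locally (a + b)%C).
Proof.
  intros Hf Hg. exact (filterlim_comp_2 _ _ _ Hf Hg (filterlim_plus (V := C_NormedModule) a b)).
Qed.

Lemma filterlim_Ropp (f : T -> R) (a : R) :
  filterlim f F (locally a) -> filterlim (fun x => - f x) F (locally (- a)).
Proof.
  intros Hf. exact (filterlim_comp _ _ _ _ _ _ _ _ Hf (filterlim_opp (V := R_NormedModule) a)).
Qed.

Lemma filterlim_Rinv (f : T -> R) (a : R) :
  a <> 0 -> filterlim f F (locally a) -> filterlim (fun x => / f x) F (locally (/ a)).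
Proof. intros Ha Hf. exact (filterlim_comp _ _ _ _ Rinv _ _ _ Hf (continuous_Rinv _ Ha)). Qed.

Lemma filterlim_Rpow (f : T -> R) (a : R) (n : nat) :
  filterlim f F (locally a) -> filterlim (fun x => f x ^ n) F (locally (a ^ n)).
Proof.
  intros Hf; induction n as [|n IH]; [apply filterlim_const|].
  apply filterlim_Rmult; auto.
Qed.

Lemma filterlim_Cmult (f g : T -> C) (a b : C) :
  filterlim f F (locally a) -> filterlim g F (locally b) ->
  filterlim (fun x => f x * g x)%C F (locally (a * b)%C).
Proof.
  rewrite !filterlim_C. intros [Hf1 Hf2] [Hg1 Hg2]. split; simpl.
  - apply filterlim_Rplus; [|apply filterlim_Ropp]; apply filterlim_Rmult; auto.
  - apply filterlim_Rplus; apply filterlim_Rmult; auto.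
Qed.

Lemma filterlim_Cinv (f : T -> C) (a : C) :
  a <> 0 -> filterlim f F (locally a) -> filterlim (fun x => / f x)%C F (locally (/ a)%C).
Proof.
  rewrite !filterlim_C. intros Ha [Hf1 Hf2].
  assert (Hn : Re a ^ 2 + Im a ^ 2 <> 0).
  { rewrite <- Cmod2_alt. apply Cmod_gt_0 in Ha. apply pow_nonzero; lra. }
  assert (Hinv : filterlim (fun x => / (Re (f x) ^ 2 + Im (f x) ^ 2)) F
    (locally (/ (Re a ^ 2 + Im a ^ 2)))).
  { apply filterlim_Rinv; [exact Hn|]. apply filterlim_Rplus; apply filterlim_Rpow; auto. }
  split; simpl; apply filterlim_Rmult; auto. apply filterlim_Ropp; auto.
Qed.

Lemma filterlim_Cpow (f : T -> C) (a : C) (n : nat) :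
  filterlim f F (locally a) -> filterlim (fun x => f x ^ n)%C F (locally (a ^ n)%C).
Proof.
  intros Hf; induction n as [|n IH]; [apply filterlim_const|].
  apply filterlim_Cmult; auto.
Qed.

Lemma filterlim_RtoC (f : T -> R) (a : R) :
  filterlim f F (locally a) -> filterlim (fun x => RtoC (f x)) F (locally (RtoC a)).
Proof. intros Hf. apply filterlim_C; split; simpl; [exact Hf | apply filterlim_const]. Qed.

End FilterlimC.

Lemma is_series_RtoC (a : nat -> R) (l : R) :
  is_series a l -> is_series (fun n => RtoC (a n)) (RtoC l).
Proof.
  intros Ha. apply filterlim_ext with (fun n => RtoC (sum_n a n)).
  - intros n; induction n as [|n IH]; [rewrite !sum_O; auto|].
    rewrite !sum_Sn, <- IH. apply RtoC_plus.
  - apply filterlim_RtoC; exact Ha.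
Qed.

Definition csin (z : C) : C := (sin (Re z) * cosh (Im z), cos (Re z) * sinh (Im z)).
Definition ccos (z : C) : C := (cos (Re z) * cosh (Im z), - (sin (Re z) * sinh (Im z))).

Lemma cosh_plus (x y : R) : cosh (x + y) = cosh x * cosh y + sinh x * sinh y.
Proof. unfold cosh, sinh. rewrite Ropp_plus_distr, !exp_plus. field. Qed.

Lemma sinh_plus (x y : R) : sinh (x + y) = sinh x * cosh y + cosh x * sinh y.
Proof. unfold cosh, sinh. rewrite Ropp_plus_distr, !exp_plus. field. Qed.

Lemma cosh_sq_sinh (y : R) : cosh y ^ 2 = 1 + sinh y ^ 2.
Proof.
  unfold cosh, sinh. assert (H : exp y * exp (- y) = 1).
  { rewrite <- exp_plus, Rplus_opp_r; apply exp_0. }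
  apply Rminus_diag_uniq. rewrite <- H. field.
Qed.

Lemma csin_plus (z w : C) : csin (z + w) = (csin z * ccos w + ccos z * csin w)%C.
Proof.
  unfold csin, ccos, Cplus, Cmult, Re, Im; simpl.
  rewrite sin_plus, cos_plus, sinh_plus, cosh_plus. f_equal; ring.
Qed.

Lemma ccos_plus (z w : C) : ccos (z + w) = (ccos z * ccos w - csin z * csin w)%C.
Proof.
  unfold Cminus, csin, ccos, Cplus, Copp, Cmult, Re, Im; simpl.
  rewrite sin_plus, cos_plus, sinh_plus, cosh_plus. f_equal; ring.
Qed.

Lemma csin_sq_plus_ccos_sq (z : C) : (csin z ^ 2 + ccos z ^ 2)%C = 1.
Proof.
  unfold csin, ccos, Cplus, Cmult, RtoC; simpl.
  assert (Hs := sin2_cos2 (Re z)). assert (Hh := cosh_sq_sinh (Im z)). unfold Rsqr in Hs.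
  set (s := sin (Re z)) in *. set (c := cos (Re z)) in *.
  f_equal; [|ring].
  transitivity ((s * s + c * c) * (cosh (Im z) ^ 2 - sinh (Im z) ^ 2)); [simpl; ring|].
  rewrite Hs, Hh; ring.
Qed.

Lemma csin_PI2 : csin (RtoC (PI / 2)) = 1.
Proof.
  unfold csin; simpl. rewrite sin_PI2, cos_PI2, cosh_0, sinh_0. unfold RtoC; f_equal; ring.
Qed.

Lemma ccos_PI2 : ccos (RtoC (PI / 2)) = 0.
Proof. unfold ccos; simpl. rewrite sin_PI2, cos_PI2, sinh_0. unfold RtoC; f_equal; ring. Qed.

Lemma csin_plus_PI2 (z : C) : csin (z + RtoC (PI / 2)) = ccos z.
Proof. rewrite csin_plus, csin_PI2, ccos_PI2; ring. Qed.

Lemma ccos_plus_PI2 (z : C) : ccos (z + RtoC (PI / 2)) = (- csin z)%C.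
Proof. rewrite ccos_plus, csin_PI2, ccos_PI2; ring. Qed.

Lemma Cmod_csin_sq (z : C) : Cmod (csin z) ^ 2 = sin (Re z) ^ 2 + sinh (Im z) ^ 2.
Proof.
  rewrite Cmod2_alt. unfold csin; simpl Re; simpl Im.
  rewrite !Rpow_mult_distr, cosh_sq_sinh.
  assert (H := sin2_cos2 (Re z)). unfold Rsqr in H.
  replace (cos (Re z) ^ 2) with (1 - sin (Re z) ^ 2) by (simpl; lra). ring.
Qed.

Lemma sinh_sq_ge (y : R) : y ^ 2 <= sinh y ^ 2.
Proof.
  destruct (MVT_gen sinh 0 y cosh) as [c [_ E]].
  - intros x _. apply is_derive_Reals, derivable_pt_lim_sinh.
  - intros x _. apply derivable_continuous_pt. exists (cosh x). apply derivable_pt_lim_sinh.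
  - rewrite sinh_0 in E. replace (sinh y) with (cosh c * y) by lra.
    rewrite Rpow_mult_distr, cosh_sq_sinh.
    nra.
Qed.

Lemma sin_sq_ge (x : R) : Rabs x <= PI / 2 -> (x / 3) ^ 2 <= sin x ^ 2.
Proof.
  assert (HP := PI_4).
  assert (G : forall t, 0 <= t <= PI / 2 -> (t / 3) ^ 2 <= sin t ^ 2).
  { intros t Ht. apply pow_incr. split; [lra|].
    destruct (sin_bound t 0) as [H _]; [lra|lra|].
    unfold sin_approx, sin_term in H; simpl in H.
    assert (t * (t * t) <= t * 4) by (apply Rmult_le_compat_l; nra). lra. }
  intros H. destruct (Rle_dec 0 x).
  - apply G. rewrite Rabs_pos_eq in H; lra.
  - replace (sin x ^ 2) with (sin (- x) ^ 2) by (rewrite sin_neg; ring).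
    replace ((x / 3) ^ 2) with ((- x / 3) ^ 2) by field.
    apply G. rewrite Rabs_left in H; lra.
Qed.

Lemma Cmod_csin_ge (z : C) : Rabs (Re z) <= PI / 2 -> Cmod z / 3 <= Cmod (csin z).
Proof.
  intros H. apply Rsqr_incr_0; [|assert (K := Cmod_ge_0 z); lra | apply Cmod_ge_0].
  rewrite !Rsqr_pow2, Cmod_csin_sq. unfold Rdiv; rewrite Rpow_mult_distr, Cmod2_alt.
  assert (H1 := sin_sq_ge _ H). assert (H2 := sinh_sq_ge (Im z)).
  assert (0 <= Im z ^ 2) by apply pow2_ge_0. simpl in *; lra.
Qed.

Lemma filterlim_csin_quotient (z : C) :
  filterlim (fun e : R => csin (e * z) / e)%C (locally' 0) (locally z).
Proof.
  assert (Hsin : filterlim (fun e => sin (e * Re z) / e) (locally' 0) (locally (Re z))).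
  { eapply filterlim_ext; [|apply (is_derive_filterlim_quotient (fun e => sin (e * Re z)) 0)].
    - intros e; simpl. rewrite Rplus_0_l, Rmult_0_l, sin_0, Rminus_0_r; reflexivity.
    - auto_derive; auto. rewrite Rmult_0_l, cos_0; ring. }
  assert (Hsinh : filterlim (fun e => sinh (e * Im z) / e) (locally' 0) (locally (Im z))).
  { eapply filterlim_ext; [|apply (is_derive_filterlim_quotient (fun e => sinh (e * Im z)) 0)].
    - intros e; simpl. rewrite Rplus_0_l, Rmult_0_l, sinh_0, Rminus_0_r; reflexivity.
    - unfold sinh. auto_derive; auto. rewrite Rmult_0_l, Ropp_0, exp_0; field. }
  assert (Hcont : forall f : R -> R, ex_derive f 0 -> filterlim f (locally' 0) (locally (f 0))).
  { intros f Hf. apply filterlim_filter_le_1 with (2 := ex_derive_continuous f 0 Hf).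
    apply filter_le_within. }
  assert (Hcos := Hcont (fun e => cos (e * Re z)) ltac:(auto_derive; auto)).
  assert (Hcosh := Hcont (fun e => cosh (e * Im z)) ltac:(unfold cosh; auto_derive; auto)).
  simpl in Hcos, Hcosh. rewrite Rmult_0_l, cos_0 in Hcos. rewrite Rmult_0_l, cosh_0 in Hcosh.
  apply filterlim_ext_loc with (fun e => (sin (e * Re z) / e * cosh (e * Im z),
    cos (e * Re z) * (sinh (e * Im z) / e))).
  - exists (mkposreal 1 Rlt_0_1); intros e _ He. unfold Cdiv, csin, Cmult, Cinv, Re, Im; simpl.
    rewrite !Rmult_0_l, Rminus_0_r, Rplus_0_r. f_equal; field; auto.
  - replace (locally z) with (locally ((Re z * 1, 1 * Im z) : C)).
    + apply filterlim_C; simpl; split; apply filterlim_Rmult; auto.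
    + f_equal. destruct z; simpl. f_equal; ring.
Qed.

(** * Sums over a row *)

Lemma sum_n_fold {G : AbelianMonoid} (u : nat -> G) (m : nat) :
  sum_n (fun n => plus (u n) (u (2 * m + 1 - n)%nat)) m = sum_n u (2 * m + 1).
Proof.
  assert (H : forall T k, (2 * k + 1 <= T)%nat ->
    plus (sum_n (fun n => plus (u n) (u (T - n)%nat)) k) (sum_n_m u (S k) (T - S k)) = sum_n u T).
  { intros T k; induction k as [|k IH]; intros HT.
    - rewrite sum_O, Nat.sub_0_r. unfold sum_n. rewrite (sum_Sn_m _ 0 T) by lia.
      replace T with (S (T - 1)) at 1 3 by lia. rewrite (sum_n_Sm _ 1 (T - 1)) by lia.
      rewrite <- plus_assoc, (plus_comm (u (S (T - 1)))). reflexivity.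
    - rewrite <- IH, sum_Sn, <- plus_assoc by lia. f_equal.
      rewrite (sum_Sn_m _ (S k)) by lia.
      replace (T - S k)%nat with (S (T - S (S k))) by lia.
      rewrite sum_n_Sm by lia.
      rewrite <- plus_assoc, (plus_comm (u (S (T - S (S k))))). reflexivity. }
  rewrite <- (H (2 * m + 1)%nat m), sum_n_m_zero, plus_zero_r by lia. reflexivity.
Qed.

Definition csc2 (z : C) : C := (/ csin z ^ 2)%C.

Lemma csin_double (z : C) : csin (2 * z) = (2 * csin z * ccos z)%C.
Proof. replace (2 * z)%C with (z + z)%C by ring. rewrite csin_plus; ring. Qed.

Lemma csin_plus_PI (z : C) : csin (z + RtoC PI) = (- csin z)%C.
Proof.
  replace (z + RtoC PI)%C with (z + RtoC (PI / 2) + RtoC (PI / 2))%C.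
  - rewrite csin_plus_PI2; apply ccos_plus_PI2.
  - rewrite <- Cplus_assoc, <- RtoC_plus. do 2 f_equal. field.
Qed.

Lemma csc2_plus_PI (z : C) : csc2 (z + RtoC PI) = csc2 z.
Proof. unfold csc2. rewrite csin_plus_PI. f_equal; ring. Qed.

Lemma csin_sq_plus_ZPI (z : C) (n : Z) : (csin (z + RtoC (IZR n * PI)) ^ 2 = csin z ^ 2)%C.
Proof.
  revert n. apply Z.bi_induction; [intros m n ->; reflexivity | |].
  - rewrite Rmult_0_l, Cplus_0_r; reflexivity.
  - intros n. replace (z + RtoC (IZR (Z.succ n) * PI))%C
      with (z + RtoC (IZR n * PI) + RtoC PI)%C.
    + rewrite csin_plus_PI.
      replace ((- csin (z + RtoC (IZR n * PI))) ^ 2)%C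
        with (csin (z + RtoC (IZR n * PI)) ^ 2)%C by ring. reflexivity.
    + rewrite <- Cplus_assoc, <- RtoC_plus, succ_IZR. do 2 f_equal. ring.
Qed.

Lemma csc2_opp (z : C) : csc2 (- z) = csc2 z.
Proof.
  unfold csc2. replace (csin (- z)) with (- csin z)%C; [f_equal; ring|].
  unfold csin, Copp, Re, Im, cosh, sinh; simpl.
  rewrite sin_neg, cos_neg, Ropp_involutive. f_equal; field.
Qed.

Lemma csin_double_neq_0 (z : C) : csin (2 * z) <> 0 -> csin z <> 0 /\ ccos z <> 0.
Proof. rewrite csin_double. intros H; split; intros E; apply H; rewrite E; ring. Qed.

Lemma csc2_double (z : C) :
  csin (2 * z) <> 0 ->
  csc2 (2 * z) = (csc2 z * csc2 (z + RtoC (PI / 2)) / 4)%C /\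
  (csc2 z + csc2 (z + RtoC (PI / 2)) = csc2 z * csc2 (z + RtoC (PI / 2)))%C.
Proof.
  intros H. destruct (csin_double_neq_0 z H) as [Hs Hc].
  unfold csc2. rewrite csin_plus_PI2, csin_double. split; [field; auto|].
  transitivity ((csin z ^ 2 + ccos z ^ 2) / (csin z ^ 2 * ccos z ^ 2))%C; [field; auto|].
  rewrite csin_sq_plus_ccos_sq. field; auto.
Qed.

(* The polynomials [phi] with [sum_n 1 / (z + n pi)^(2 p) = phi (1 / sin^2 z)].  The first
   condition is the duplication formula in terms of [u = 1 / sin^2 z], [v = 1 / cos^2 z]; the
   other two say that [phi u] is [u^p] plus terms of degree between [1] and [p - 1]. *)
Record row_polynomial (p : nat) (phi : C -> C) : Prop := {
  row_duplication : forall u v : C,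
    (u + v = u * v)%C -> (4 ^ p * phi (u * v / 4) = phi u + phi v)%C;
  row_domination : forall M : R, exists K : R, 0 < K /\ forall (t : R) (u : C),
    0 < t <= 1 -> Cmod (t * u) <= M -> Cmod (t ^ p * phi u) <= K * Cmod (t * u);
  row_leading : forall (t : nat -> R) (u : nat -> C) (v : C),
    is_lim_seq t 0 -> filterlim (fun j => t j * u j)%C eventually (locally v) ->
    filterlim (fun j => t j ^ p * phi (u j))%C eventually (locally (v ^ p)%C) }.

Lemma two_pow_pos (j : nat) : (0 < 2 ^ j)%nat.
Proof. apply Nat.neq_0_lt_0, Nat.pow_nonzero; lia. Qed.

Definition half_pow (j : nat) : R := / 2 ^ j.

Lemma half_pow_bounds (j : nat) : 0 < half_pow j <= 1.
Proof.
  unfold half_pow. assert (H : 1 <= 2 ^ j) by (apply pow_R1_Rle; lra).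
  split; [apply Rinv_0_lt_compat; lra|].
  rewrite <- Rinv_1. apply Rinv_le_contravar; lra.
Qed.

Lemma half_pow_S (j : nat) : half_pow j = 2 * half_pow (S j).
Proof. unfold half_pow; simpl. field. apply pow_nonzero; lra. Qed.

Lemma is_lim_seq_half_pow : is_lim_seq half_pow 0.
Proof.
  apply is_lim_seq_ext with (fun n => (/ 2) ^ n); [intros; apply pow_inv|].
  apply is_lim_seq_geom. rewrite Rabs_pos_eq; lra.
Qed.

Definition fold_neg_pred (u : Z -> C) (n : nat) : C := (u (Z.of_nat n) + u (- Z.of_nat n - 1)%Z)%C.

Section Row.
Variables (p : nat) (phi : C -> C) (z : C).
Hypothesis phi_row : row_polynomial p phi.

Definition row_point (n : Z) : C := (z + RtoC (IZR n * PI))%C.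

Definition row_term (j : nat) (n : Z) : C :=
  (RtoC (half_pow j ^ 2) ^ p * phi (csc2 (half_pow j * row_point n)))%C.

Lemma csin_row_point_neq_0 (j : nat) (n : Z) :
  csin z <> 0 -> csin (half_pow j * row_point n) <> 0.
Proof.
  intros Hz; induction j as [|j IH].
  - unfold half_pow; simpl. rewrite Rinv_1, Cmult_1_l. intros E.
    assert (P := csin_sq_plus_ZPI z n). fold (row_point n) in P. rewrite E in P.
    apply (Cpow_nz _ 2 Hz). rewrite <- P. ring.
  - apply csin_double_neq_0. rewrite half_pow_S, RtoC_mult in IH.
    rewrite Cmult_assoc. exact IH.
Qed.

Lemma half_pow_row_point_shift (i j : nat) (n : Z) :
  (half_pow j * row_point (n + Z.of_nat (2 ^ i)))%C
  = (half_pow j * row_point n + RtoC (half_pow j * 2 ^ i * PI))%C.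
Proof.
  unfold row_point. rewrite plus_IZR, <- INR_IZR_INZ, pow_INR.
  change (INR 2) with 2. rewrite Rmult_plus_distr_r, RtoC_plus, !RtoC_mult. ring.
Qed.

Lemma row_term_period (j : nat) (n : Z) : row_term j (n + Z.of_nat (2 ^ j)) = row_term j n.
Proof.
  unfold row_term. rewrite half_pow_row_point_shift.
  replace (half_pow j * 2 ^ j * PI) with PI; [rewrite csc2_plus_PI; reflexivity|].
  unfold half_pow; field. apply pow_nonzero; lra.
Qed.

Lemma row_term_split (j : nat) (n : Z) :
  csin z <> 0 -> row_term j n = (row_term (S j) n + row_term (S j) (n + Z.of_nat (2 ^ j)))%C.
Proof.
  intros Hz. unfold row_term. rewrite half_pow_row_point_shift.
  replace (half_pow (S j) * 2 ^ j * PI) with (PI / 2)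
    by (unfold half_pow; simpl; field; apply pow_nonzero; lra).
  assert (Hd := csin_row_point_neq_0 j n Hz).
  rewrite half_pow_S, RtoC_mult, <- Cmult_assoc in *.
  set (w := (half_pow (S j) * row_point n)%C) in *.
  destruct (csc2_double w Hd) as [-> Hsum].
  rewrite <- Cmult_plus_distr_l, <- (row_duplication p phi phi_row) by exact Hsum.
  rewrite Cmult_assoc, <- Cpow_mult_l. do 2 f_equal.
  rewrite !RtoC_pow, RtoC_mult. simpl; ring.
Qed.

Definition folded_row_term (j : nat) : nat -> C := fold_neg_pred (row_term j).

Lemma folded_row_term_split (j n : nat) :
  csin z <> 0 -> (n <= 2 * (2 ^ j - 1) + 1)%nat ->
  folded_row_term (S j) n
  = (folded_row_term (S (S j)) n + folded_row_term (S (S j)) (2 * (2 ^ j - 1) + 1 - n))%C.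
Proof.
  intros Hz Hn. unfold folded_row_term, fold_neg_pred.
  assert (Hpow := two_pow_pos j).
  rewrite !(row_term_split (S j)) by exact Hz.
  rewrite <- (row_term_period (S (S j)) (- Z.of_nat (2 * (2 ^ j - 1) + 1 - n) - 1)).
  replace (- Z.of_nat (2 * (2 ^ j - 1) + 1 - n) - 1 + Z.of_nat (2 ^ S (S j)))%Z
    with (Z.of_nat n + Z.of_nat (2 ^ S j))%Z by (simpl; lia).
  replace (- Z.of_nat n - 1 + Z.of_nat (2 ^ S j))%Z
    with (Z.of_nat (2 * (2 ^ j - 1) + 1 - n)) by (simpl; lia).
  ring.
Qed.

Lemma csc2_multiplication (j : nat) :
  csin z <> 0 -> phi (csc2 z) = sum_n (folded_row_term (S j)) (2 ^ j - 1).
Proof.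
  intros Hz; induction j as [|j IH].
  - simpl. rewrite sum_O. unfold folded_row_term, fold_neg_pred; simpl.
    transitivity (row_term 0 0).
    + unfold row_term, row_point, half_pow; simpl.
      rewrite Rinv_1, Rmult_0_l, Cplus_0_r, !Rmult_1_r, Cpow_1_l, !Cmult_1_l. reflexivity.
    + rewrite (row_term_split 0) by exact Hz. rewrite <- (row_term_period 1 (-1)). reflexivity.
  - rewrite IH.
    replace (2 ^ S j - 1)%nat with (2 * (2 ^ j - 1) + 1)%nat.
    + rewrite <- sum_n_fold. apply sum_n_ext_loc; intros n Hn.
      apply folded_row_term_split; [exact Hz | lia].
    + assert (Hpow := two_pow_pos j). simpl; lia.
Qed.

Lemma filterlim_row_term (n : Z) :
  csin z <> 0 -> row_point n <> 0 ->
  filterlim (fun j => row_term j n) eventually (locally (/ row_point n ^ (2 * p))%C).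
Proof.
  intros Hz Hw. rewrite Cpow_mult_r, <- Cpow_inv by (apply Cpow_nz; exact Hw).
  apply (row_leading p phi phi_row).
  - replace (Finite 0) with (Finite (0 * 0)) by (f_equal; ring).
    apply is_lim_seq_ext with (fun j => half_pow j * half_pow j); [intros; ring|].
    apply is_lim_seq_mult'; apply is_lim_seq_half_pow.
  - set (w := row_point n) in *.
    assert (L : filterlim (fun j => csin (half_pow j * w) / half_pow j)%C eventually (locally w)).
    { apply (filterlim_comp _ _ _ half_pow (fun e : R => csin (e * w) / e)%C _ (locally' 0));
        [|apply filterlim_csin_quotient].
      intros P HP. destruct (is_lim_seq_half_pow _ HP) as [N HN].
      exists N; intros j Hj. apply HN; auto. assert (B := half_pow_bounds j). lra. }
    apply filterlim_Cpow with (n := 2%nat) in L.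
    apply filterlim_Cinv in L; [|apply Cpow_nz; exact Hw].
    apply filterlim_ext with (2 := L). intros j. unfold csc2, Cdiv.
    assert (Hh : RtoC (half_pow j) <> 0).
    { intros E. apply RtoC_inj in E. assert (B := half_pow_bounds j). lra. }
    rewrite RtoC_pow. field. split; [apply csin_row_point_neq_0; exact Hz | exact Hh].
Qed.

Lemma row_term_bound (delta : R) :
  0 < delta -> exists K : R, 0 < K /\ forall (j : nat) (n : Z),
    delta <= Cmod (row_point n) -> Rabs (Re (half_pow j * row_point n)) <= PI / 2 ->
    Cmod (row_term j n) <= K * / Cmod (row_point n) ^ 2.
Proof.
  intros Hd. destruct (row_domination p phi phi_row (9 * / delta ^ 2)) as [K [HK H]].
  exists (K * 9). split; [lra|]. intros j n Hn HRe. unfold row_term.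
  assert (Hh := half_pow_bounds j). set (e := half_pow j) in *. set (w := row_point n) in *.
  assert (Hu : Cmod (RtoC (e ^ 2) * csc2 (e * w)) <= 9 * / Cmod w ^ 2).
  { assert (Hge := Cmod_csin_ge (e * w) HRe).
    rewrite Cmod_mult, Cmod_R, (Rabs_pos_eq e) in Hge by lra.
    assert (Hew : 0 < e * Cmod w) by (apply Rmult_lt_0_compat; lra).
    unfold csc2. rewrite Cmod_mult, Cmod_inv, Cmod_pow, Cmod_R, Rabs_pos_eq.
    - apply Rle_trans with (e ^ 2 * / (e * Cmod w / 3) ^ 2); [|right; field; lra].
      apply Rmult_le_compat_l; [apply pow2_ge_0|].
      apply Rinv_le_contravar; [apply pow_lt; lra | apply pow_incr; lra].
    - apply pow2_ge_0.
    - apply Cpow_nz. apply Cmod_gt_0. lra. }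
  rewrite Rmult_assoc. apply Rle_trans with (K * Cmod (RtoC (e ^ 2) * csc2 (e * w))).
  - apply H; [split; [apply pow_lt; lra | rewrite <- (pow1 2); apply pow_incr; lra]|].
    eapply Rle_trans; [exact Hu|]. apply Rmult_le_compat_l; [lra|].
    apply Rinv_le_contravar; [apply pow_lt; lra | apply pow_incr; lra].
  - apply Rmult_le_compat_l; lra.
Qed.

Hypothesis z_strip : 0 <= Re z <= PI / 2.
Hypothesis z_neq_0 : z <> 0.

Lemma Re_row_point (n : Z) : Re (row_point n) = Re z + IZR n * PI.
Proof. reflexivity. Qed.

Definition row_gap : R := Rmin (Cmod z) 1.

Lemma row_gap_pos : 0 < row_gap.
Proof. apply Rmin_pos; [apply Cmod_gt_0; exact z_neq_0 | lra]. Qed.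

Lemma row_point_lower_bound (n : nat) :
  row_gap * INR (S n) <= Cmod (row_point (Z.of_nat n)) /\
  row_gap * INR (S n) <= Cmod (row_point (- Z.of_nat n - 1)).
Proof.
  assert (Hc1 : row_gap <= 1) by apply Rmin_r.
  assert (Hcz : row_gap <= Cmod z) by apply Rmin_l.
  assert (HP := PI2_3_2). assert (Hn := pos_INR n).
  assert (HPn : 3 * INR n <= INR n * PI) by nra.
  rewrite S_INR. split.
  - destruct n as [|n].
    + unfold row_point. simpl. rewrite Rmult_0_l, Cplus_0_r. lra.
    + eapply Rle_trans; [|apply re_le_Cmod].
      rewrite Re_row_point, <- INR_IZR_INZ, Rabs_pos_eq by lra.
      rewrite S_INR in *. assert (Hm := pos_INR n). nra.
  - eapply Rle_trans; [|apply re_le_Cmod].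
    rewrite Re_row_point, minus_IZR, opp_IZR, <- INR_IZR_INZ, Rabs_left1 by lra. nra.
Qed.

Lemma row_point_scaled_Re (j n : nat) :
  (n < 2 ^ j)%nat ->
  Rabs (Re (half_pow (S j) * row_point (Z.of_nat n))) <= PI / 2 /\
  Rabs (Re (half_pow (S j) * row_point (- Z.of_nat n - 1))) <= PI / 2.
Proof.
  intros Hn. assert (Hh := half_pow_bounds (S j)).
  assert (Hpow : half_pow (S j) * 2 ^ j = / 2).
  { unfold half_pow; simpl; field. apply pow_nonzero; lra. }
  assert (HnR : INR n + 1 <= 2 ^ j).
  { rewrite <- S_INR. replace (2 ^ j) with (INR (2 ^ j)) by apply pow_INR. apply le_INR; lia. }
  assert (Hn0 := pos_INR n).
  assert (HRe : forall m : Z, Re (half_pow (S j) * row_point m)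
    = half_pow (S j) * (Re z + IZR m * PI))
    by (intros m; rewrite <- Re_row_point; unfold Re; simpl; ring).
  assert (Hle : forall x, - (2 ^ j * PI) <= x <= 2 ^ j * PI ->
    Rabs (half_pow (S j) * x) <= PI / 2).
  { intros x Hx. rewrite Rabs_mult, (Rabs_pos_eq (half_pow (S j))) by lra.
    replace (PI / 2) with (half_pow (S j) * (2 ^ j * PI)) by (rewrite <- Rmult_assoc, Hpow; field).
    apply Rmult_le_compat_l; [lra|]. apply Rabs_le; lra. }
  rewrite !HRe. split; apply Hle.
  - rewrite <- INR_IZR_INZ. nra.
  - rewrite minus_IZR, opp_IZR, <- INR_IZR_INZ. nra.
Qed.

Lemma csin_neq_0_strip : csin z <> 0.
Proof.
  assert (H := Cmod_csin_ge z ltac:(rewrite Rabs_pos_eq; lra)).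
  apply Cmod_gt_0. apply Cmod_gt_0 in z_neq_0. lra.
Qed.

Lemma folded_row_term_bound :
  exists B : R, 0 < B /\ forall j n : nat, (n < 2 ^ j)%nat ->
    Cmod (folded_row_term (S j) n) <= B * / INR (S n) ^ 2.
Proof.
  set (c := row_gap). assert (Hc : 0 < c) by apply row_gap_pos.
  destruct (row_term_bound c Hc) as [K [HK Hbound]].
  assert (HKc : 0 < K * / c ^ 2) by (apply Rmult_lt_0_compat, Rinv_0_lt_compat, pow_lt; auto).
  exists (2 * (K * / c ^ 2)). split; [lra|]. intros j n Hn.
  assert (HS : 1 <= INR (S n)) by (rewrite S_INR; assert (H := pos_INR n); lra).
  assert (Hterm : forall m, c * INR (S n) <= Cmod (row_point m) ->
    Rabs (Re (half_pow (S j) * row_point m)) <= PI / 2 ->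
    Cmod (row_term (S j) m) <= K * / c ^ 2 * / INR (S n) ^ 2).
  { intros m Hm HRe. eapply Rle_trans; [apply Hbound; [nra | exact HRe]|].
    rewrite Rmult_assoc, <- Rinv_mult, <- Rpow_mult_distr. apply Rmult_le_compat_l; [lra|].
    apply Rinv_le_contravar; [apply pow_lt; nra | apply pow_incr; nra]. }
  destruct (row_point_lower_bound n) as [L1 L2].
  destruct (row_point_scaled_Re j n Hn) as [R1 R2].
  eapply Rle_trans; [apply Cmod_triangle|].
  assert (T1 := Hterm _ L1 R1). assert (T2 := Hterm _ L2 R2). lra.
Qed.

Lemma filterlim_folded_row_term (n : nat) :
  filterlim (fun j => folded_row_term (S j) n) eventually
    (locally (fold_neg_pred (fun n => / row_point n ^ (2 * p))%C n)).
Proof.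
  assert (Hc : 0 < row_gap * INR (S n)).
  { apply Rmult_lt_0_compat; [exact row_gap_pos | apply lt_0_INR; lia]. }
  destruct (row_point_lower_bound n) as [L1 L2].
  apply filterlim_Cplus; apply (filterlim_comp _ _ _ S (fun j => row_term j _) _ eventually);
    try (apply filterlim_row_term; [apply csin_neq_0_strip | apply Cmod_gt_0; lra]);
    (intros P [N HN]; exists N; intros j Hj; apply HN; lia).
Qed.

Lemma is_series_row :
  is_series (fold_neg_pred (fun n => / (z + RtoC (IZR n * PI)) ^ (2 * p))%C) (phi (csc2 z)).
Proof.
  destruct folded_row_term_bound as [B [HB Hbound]].
  set (a j n := if Nat.ltb n (2 ^ j) then folded_row_term (S j) n else RtoC 0).
  destruct (filterlim_series_dominated (F := eventually) (V := C_CompleteNormedModule)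
    a (fun _ => phi (csc2 z)) (fold_neg_pred (fun n => / row_point n ^ (2 * p))%C)
    (fun n => B * / INR (S n) ^ 2)) as [L [HL HL']].
  - apply (ex_series_scal_l (V := R_NormedModule)), ex_series_inv_sq.
  - apply filter_forall; intros j; split.
    + assert (Hpow := two_pow_pos j). replace (phi (csc2 z)) with (sum_n (a j) (2 ^ j - 1)).
      * apply (is_series_finite_support (V := C_NormedModule)). intros n Hn. unfold a.
        destruct (Nat.ltb_spec n (2 ^ j)); [lia | reflexivity].
      * rewrite (csc2_multiplication j csin_neq_0_strip). apply sum_n_ext_loc; intros n Hn.
        unfold a. destruct (Nat.ltb_spec n (2 ^ j)); [reflexivity | lia].
    + intros n. change (Cmod (a j n) <= B * / INR (S n) ^ 2). unfold a.
      destruct (Nat.ltb_spec n (2 ^ j)); [apply Hbound; auto|].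
      rewrite Cmod_0. apply Rmult_le_pos; [lra|].
      left; apply Rinv_0_lt_compat, pow_lt, lt_0_INR; lia.
  - intros n. apply filterlim_ext_loc with (2 := filterlim_folded_row_term n).
    exists n; intros j Hj. unfold a. destruct (Nat.ltb_spec n (2 ^ j)) as [|Hn]; auto.
    exfalso. assert (H := Nat.pow_gt_lin_r 2 j). lia.
  - replace (phi (csc2 z)) with L; [exact HL|].
    apply (filterlim_locally_unique (V := C_NormedModule) (F := eventually)
      (fun _ : nat => phi (csc2 z))); [exact HL' | apply filterlim_const].
Qed.

End Row.

Definition row_quartic (u : C) : C := (u ^ 2 - 2 / 3 * u)%C.
Definition row_sextic (u : C) : C := (u ^ 3 - u ^ 2 + 2 / 15 * u)%C.

Lemma Cmod_scaled_power_le (i j : nat) (t M : R) (u : C) :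
  0 < t <= 1 -> Cmod (t * u) <= M ->
  Cmod (t ^ i * (t * u) ^ S j) <= M ^ j * Cmod (t * u).
Proof.
  intros Ht HM. rewrite Cmod_mult, !Cmod_pow, Cmod_R, (Rabs_pos_eq t) by lra.
  assert (H0 := Cmod_ge_0 (t * u)). set (r := Cmod (t * u)) in *.
  assert (Hti : 0 <= t ^ i <= 1).
  { split; [apply pow_le; lra | rewrite <- (pow1 i); apply pow_incr; lra]. }
  assert (Hr : 0 <= r ^ j <= M ^ j) by (split; [apply pow_le; auto | apply pow_incr; auto]).
  simpl. rewrite <- Rmult_assoc, (Rmult_comm (t ^ i)), Rmult_assoc, (Rmult_comm (M ^ j)).
  apply Rmult_le_compat_l; nra.
Qed.

Lemma row_polynomial_quartic : row_polynomial 2 row_quartic.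
Proof.
  split; unfold row_quartic.
  - intros u v H.
    transitivity ((u + v) ^ 2 - 2 * (u * v) - 2 / 3 * (u + v))%C; [rewrite H; field | field].
  - intros M. exists (Rabs M + 1). split; [assert (K := Rabs_pos M); lra|]. intros t u Ht HM.
    replace (t ^ 2 * (u ^ 2 - 2 / 3 * u))%C
      with (t ^ 0 * (t * u) ^ 2 + RtoC (- (2 / 3)) * (t ^ 1 * (t * u) ^ 1))%C
      by (rewrite RtoC_opp, RtoC_div by lra; field).
    eapply Rle_trans; [apply Cmod_triangle|].
    rewrite (Cmod_mult (RtoC _)), Cmod_R, Rabs_Ropp, (Rabs_pos_eq (2 / 3)) by lra.
    assert (B2 := Cmod_scaled_power_le 0 1 t M u Ht HM).
    assert (B1 := Cmod_scaled_power_le 1 0 t M u Ht HM).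
    assert (H0 := Cmod_ge_0 (t * u)).
    assert (HMM := Rmult_le_compat_r _ _ _ (Cmod_ge_0 (t * u)) (Rle_abs M)).
    rewrite pow_1 in B2. rewrite pow_O in B1. lra.
  - intros t u v Ht Hv.
    apply filterlim_ext with (fun j => (t j * u j) ^ 2 + - (2 / 3) * t j * (t j * u j))%C;
      [intros j; field|].
    replace (v ^ 2)%C with (v ^ 2 + - (2 / 3) * 0 * v)%C by field.
    apply filterlim_Cplus; [apply filterlim_Cpow; exact Hv|].
    apply filterlim_Cmult; [apply filterlim_Cmult | exact Hv];
      [apply filterlim_const | apply filterlim_RtoC; exact Ht].
Qed.

Lemma row_polynomial_sextic : row_polynomial 3 row_sextic.
Proof.
  split; unfold row_sextic.
  - intros u v H.
    transitivity ((u + v) ^ 3 - 3 * (u * v) * (u + v) - ((u + v) ^ 2 - 2 * (u * v))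
      + 2 / 15 * (u + v))%C; [rewrite H; field | field].
  - intros M. exists (Rabs M ^ 2 + Rabs M + 1).
    split; [assert (K := Rabs_pos M); assert (K2 := pow2_ge_0 (Rabs M)); lra|]. intros t u Ht HM.
    replace (t ^ 3 * (u ^ 3 - u ^ 2 + 2 / 15 * u))%C
      with (t ^ 0 * (t * u) ^ 3 + (RtoC (- (1)) * (t ^ 1 * (t * u) ^ 2)
        + RtoC (2 / 15) * (t ^ 2 * (t * u) ^ 1)))%C
      by (rewrite RtoC_opp, RtoC_div by lra; field).
    eapply Rle_trans; [apply Cmod_triangle|].
    eapply Rle_trans; [apply Rplus_le_compat_l, Cmod_triangle|].
    rewrite (Cmod_mult (RtoC (- (1)))), (Cmod_mult (RtoC (2 / 15))), !Cmod_R.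
    rewrite Rabs_Ropp, (Rabs_pos_eq 1), (Rabs_pos_eq (2 / 15)) by lra.
    assert (B3 := Cmod_scaled_power_le 0 2 t M u Ht HM).
    assert (B2 := Cmod_scaled_power_le 1 1 t M u Ht HM).
    assert (B1 := Cmod_scaled_power_le 2 0 t M u Ht HM).
    assert (H0 := Cmod_ge_0 (t * u)).
    assert (HMM := Rmult_le_compat_r _ _ _ (Cmod_ge_0 (t * u)) (Rle_abs M)).
    rewrite pow_1 in B2. rewrite pow_O in B1. rewrite pow2_abs. lra.
  - intros t u v Ht Hv.
    assert (Ht' := filterlim_RtoC t 0 Ht).
    apply filterlim_ext with (fun j => (t j * u j) ^ 3 +
      (- (1) * t j * (t j * u j) ^ 2 + 2 / 15 * (t j) ^ 2 * (t j * u j)))%C; [intros j; field|].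
    replace (v ^ 3)%C with (v ^ 3 + (- (1) * 0 * v ^ 2 + 2 / 15 * 0 ^ 2 * v))%C by field.
    apply filterlim_Cplus; [apply filterlim_Cpow; exact Hv | apply filterlim_Cplus].
    + apply filterlim_Cmult; [apply filterlim_Cmult | apply filterlim_Cpow; exact Hv];
        [apply filterlim_const | exact Ht'].
    + apply filterlim_Cmult; [apply filterlim_Cmult | exact Hv];
        [apply filterlim_const | apply filterlim_Cpow; exact Ht'].
Qed.

(** * Sums over a rectangular lattice *)

Definition fold_opp (u : Z -> C) (n : nat) : C :=
  match n with
  | O => u 0%Z
  | S _ => (u (Z.of_nat n) + u (- Z.of_nat n)%Z)%C
  end.

Lemma fold_opp_ext (u v : Z -> C) (n : nat) :
  (forall m, u m = v m) -> fold_opp u n = fold_opp v n.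
Proof. intros H; destruct n; simpl; rewrite !H; reflexivity. Qed.

Lemma fold_opp_scal (a : C) (u : Z -> C) (n : nat) :
  fold_opp (fun m => a * u m)%C n = (a * fold_opp u n)%C.
Proof. destruct n; simpl; ring. Qed.

Lemma is_series_fold_opp (u : Z -> C) (l : C) :
  is_series (fold_neg_pred u) l ->
  filterlim (fun n => u (- Z.of_nat n - 1)%Z) eventually (locally (RtoC 0)) ->
  is_series (fold_opp u) l.
Proof.
  intros Hl Hu. replace l with (l + - (1) * 0)%C by ring.
  apply filterlim_ext with
    (fun N => sum_n (fold_neg_pred u) N + - (1) * u (- Z.of_nat N - 1)%Z)%C.
  - intros N; induction N as [|N IH].
    + rewrite !sum_O. unfold fold_neg_pred; simpl. ring.
    + rewrite !sum_Sn, <- IH. unfold fold_neg_pred, fold_opp.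
      replace (- Z.of_nat (S N))%Z with (- Z.of_nat N - 1)%Z by lia.
      unfold plus; cbn -[Z.of_nat Z.sub]. ring.
  - apply filterlim_Cplus; [exact Hl|].
    apply filterlim_Cmult; [apply filterlim_const | exact Hu].
Qed.

Lemma zrange_S (N : nat) :
  zrange (S N) = ((- Z.of_nat (S N))%Z :: zrange N ++ Z.of_nat (S N) :: nil).
Proof.
  unfold zrange.
  replace (2 * S N + 1)%nat with (S (S (2 * N + 1))) by lia.
  rewrite seq_S. change (seq 0 (S (2 * N + 1))) with (0%nat :: seq 1 (2 * N + 1)).
  rewrite <- seq_shift, map_app, !map_cons, map_map. cbn [app map].
  f_equal. f_equal; [apply map_ext; intros; lia|]. f_equal. lia.
Qed.

Lemma fold_right_Cplus_app (l1 l2 : list C) :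
  fold_right Cplus 0 (l1 ++ l2) = (fold_right Cplus 0 l1 + fold_right Cplus 0 l2)%C.
Proof. induction l1 as [|a l1 IH]; simpl; [ring | rewrite IH; ring]. Qed.

Lemma fold_right_Cplus_flat_map {A : Type} (g : A -> list C) (l : list A) :
  fold_right Cplus 0 (flat_map g l)
  = fold_right Cplus 0 (map (fun a => fold_right Cplus 0 (g a)) l).
Proof. induction l as [|a l IH]; simpl; auto. rewrite fold_right_Cplus_app, IH. reflexivity. Qed.

Lemma fold_right_Cplus_zrange (u : Z -> C) (N : nat) :
  fold_right Cplus 0 (map u (zrange N)) = sum_n (fold_opp u) N.
Proof.
  induction N as [|N IH]; [rewrite sum_O; simpl; ring|].
  rewrite zrange_S, map_cons, map_app, sum_Sn, <- IH.
  simpl fold_right. rewrite fold_right_Cplus_app. unfold plus, fold_opp; simpl. ring.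
Qed.

Lemma is_series_even_odd {K : AbsRing} {V : NormedModule K} (a : nat -> V) (l : V) :
  is_series a l -> is_series (fun n => plus (a (2 * n)%nat) (a (2 * n + 1)%nat)) l.
Proof.
  intros H. apply filterlim_ext with (fun N => sum_n a (2 * N + 1)).
  - intros N; induction N as [|N IH].
    + simpl. rewrite sum_Sn, !sum_O. reflexivity.
    + rewrite sum_Sn, <- IH. replace (2 * S N + 1)%nat with (S (S (2 * N + 1))) by lia.
      replace (2 * S N)%nat with (S (2 * N + 1)) by lia.
      rewrite !sum_Sn, plus_assoc. reflexivity.
  - apply (filterlim_comp _ _ _ (fun N => (2 * N + 1)%nat) (sum_n a) _ eventually); [|exact H].
    intros P [N HN]; exists N; intros n Hn; apply HN; lia.
Qed.

Lemma inv_1_plus_sq_pos (x : R) : 0 < / (1 + x ^ 2).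
Proof. assert (K := pow2_ge_0 x). apply Rinv_0_lt_compat; lra. Qed.

Lemma ex_series_inv_1_plus_sq : ex_series (fun n => / (1 + INR n ^ 2)).
Proof.
  apply (ex_series_Rabs_le _ (fun n => 2 * / INR (S n) ^ 2)).
  - intros n. rewrite S_INR. assert (H := pos_INR n).
    rewrite Rabs_pos_eq by (left; apply inv_1_plus_sq_pos).
    replace (2 * / (INR n + 1) ^ 2) with (/ ((INR n + 1) ^ 2 / 2)) by (field; lra).
    apply Rinv_le_contravar; [|assert (K := pow2_ge_0 (INR n - 1)); lra].
    assert (0 < (INR n + 1) ^ 2) by (apply pow_lt; lra). lra.
  - apply (ex_series_scal_l (V := R_NormedModule)), ex_series_inv_sq.
Qed.

Section Lattice.
Variable y : R.
Hypothesis y_pos : 0 < y.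

Definition lattice_gap_sq : R := Rmin 1 (y ^ 2) / 2.

Lemma lattice_gap_sq_pos : 0 < lattice_gap_sq.
Proof. apply Rdiv_lt_0_compat; [apply Rmin_pos; [lra | apply pow_lt; auto] | lra]. Qed.

Definition column_point (m : Z) : C := (0, - (IZR m * y)).

Lemma lattice_point_Cmod_sq_ge (m n : Z) :
  (m <> 0 \/ n <> 0)%Z ->
  lattice_gap_sq * (1 + IZR m ^ 2 + IZR n ^ 2)
    <= Cmod (column_point m + RtoC (IZR n * PI)) ^ 2.
Proof.
  intros Hmn. rewrite Cmod2_alt. simpl Re; simpl Im.
  assert (HP := PI2_3_2). assert (Hy1 := Rmin_l 1 (y ^ 2)). assert (Hy2 := Rmin_r 1 (y ^ 2)).
  assert (Hc := lattice_gap_sq_pos). unfold lattice_gap_sq in *.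
  assert (Hm := pow2_ge_0 (IZR m)). assert (Hn := pow2_ge_0 (IZR n)).
  assert (H1 : 1 <= IZR m ^ 2 + IZR n ^ 2).
  { rewrite <- !Rsqr_pow2. unfold Rsqr. rewrite <- !mult_IZR, <- plus_IZR. apply IZR_le.
    destruct Hmn; nia. }
  set (c := Rmin 1 (y ^ 2)) in *.
  replace ((0 + IZR n * PI) ^ 2 + (- (IZR m * y) + 0) ^ 2)
    with (PI ^ 2 * IZR n ^ 2 + y ^ 2 * IZR m ^ 2) by ring.
  assert (c * IZR n ^ 2 <= PI ^ 2 * IZR n ^ 2) by (apply Rmult_le_compat_r; [auto | nra]).
  assert (c * IZR m ^ 2 <= y ^ 2 * IZR m ^ 2) by (apply Rmult_le_compat_r; auto).
  nra.
Qed.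

Lemma lattice_point_neq_0 (m n : Z) :
  (m <> 0 \/ n <> 0)%Z -> (column_point m + RtoC (IZR n * PI))%C <> 0.
Proof.
  intros Hmn E. assert (H := lattice_point_Cmod_sq_ge m n Hmn). rewrite E, Cmod_0 in H.
  assert (Hc := lattice_gap_sq_pos). nra.
Qed.

Variables (p : nat) (phi : C -> C).
Hypothesis phi_row : row_polynomial p phi.
Hypothesis p_ge_2 : (2 <= p)%nat.

Definition lattice_term (m n : Z) : C :=
  if (Z.eqb m 0 && Z.eqb n 0)%bool then 0
  else (/ (column_point m + RtoC (IZR n * PI)) ^ (2 * p))%C.

Lemma lattice_term_bound :
  exists B : R, 0 < B /\ forall m n : Z,
    Cmod (lattice_term m n) <= B * / (1 + IZR m ^ 2) * / (1 + IZR n ^ 2).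
Proof.
  set (c := lattice_gap_sq). assert (Hc : 0 < c) by apply lattice_gap_sq_pos.
  exists (/ c ^ p). split; [apply Rinv_0_lt_compat, pow_lt; auto|]. intros m n.
  assert (Hm := pow2_ge_0 (IZR m)). assert (Hn := pow2_ge_0 (IZR n)).
  assert (HB : 0 < / c ^ p * / (1 + IZR m ^ 2) * / (1 + IZR n ^ 2)).
  { repeat apply Rmult_lt_0_compat; apply Rinv_0_lt_compat; try lra. apply pow_lt; auto. }
  unfold lattice_term. destruct (Z.eqb m 0 && Z.eqb n 0)%bool eqn:E; [rewrite Cmod_0; lra|].
  assert (Hmn : (m <> 0 \/ n <> 0)%Z).
  { apply Bool.andb_false_iff in E. rewrite !Z.eqb_neq in E. exact E. }
  assert (Hge := lattice_point_Cmod_sq_ge m n Hmn). fold c in Hge.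
  assert (Hw := lattice_point_neq_0 m n Hmn).
  set (w := (column_point m + RtoC (IZR n * PI))%C) in *.
  set (q := 1 + IZR m ^ 2 + IZR n ^ 2) in *. assert (Hq : 1 <= q) by (unfold q; lra).
  rewrite Cmod_inv, Cmod_pow, pow_mult, <- !Rinv_mult by (apply Cpow_nz; exact Hw).
  apply Rinv_le_contravar; [repeat apply Rmult_lt_0_compat; try apply pow_lt; lra|].
  apply Rle_trans with ((c * q) ^ p);
    [|apply pow_incr; split; [apply Rmult_le_pos; lra | exact Hge]].
  rewrite Rpow_mult_distr, Rmult_assoc. apply Rmult_le_compat_l; [apply pow_le; lra|].
  apply Rle_trans with (q ^ 2); [unfold q; nra | apply Rle_pow; auto].
Qed.

Definition row_partial (N : nat) (m : Z) : C := sum_n (fold_opp (lattice_term m)) N.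

Lemma row_partial_bound :
  exists B : R, 0 < B /\ forall (N : nat) (m : Z), Cmod (row_partial N m) <= B * / (1 + IZR m ^ 2).
Proof.
  destruct lattice_term_bound as [B [HB Hterm]].
  assert (Hpos : forall n, 0 < / (1 + INR n ^ 2)) by (intros n; apply inv_1_plus_sq_pos).
  set (Z2 := Series (fun n => / (1 + INR n ^ 2))).
  assert (HZ := Series_correct _ ex_series_inv_1_plus_sq). fold Z2 in HZ.
  assert (HZpos : 0 < Z2).
  { assert (K := proj2 (sum_n_le_is_series _ _ 0 (fun n => Rlt_le _ _ (Hpos n)) HZ)).
    rewrite sum_O in K. specialize (Hpos 0%nat). lra. }
  exists (2 * B * Z2). split; [repeat apply Rmult_lt_0_compat; lra|]. intros N m.
  assert (Hm := inv_1_plus_sq_pos (IZR m)).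
  set (v := 2 * B * / (1 + IZR m ^ 2)).
  assert (Hv : 0 < v) by (repeat apply Rmult_lt_0_compat; lra).
  assert (Hfold : forall n, Cmod (fold_opp (lattice_term m) n) <= v * / (1 + INR n ^ 2)).
  { intros [|n]; unfold fold_opp.
    - eapply Rle_trans; [apply Hterm|]. simpl INR. specialize (Hpos 0%nat). simpl INR in Hpos.
      apply Rmult_le_compat_r; [lra | unfold v; nra].
    - eapply Rle_trans; [apply Cmod_triangle|].
      assert (T1 := Hterm m (Z.of_nat (S n))). assert (T2 := Hterm m (- Z.of_nat (S n))%Z).
      rewrite opp_IZR, <- INR_IZR_INZ in T2. rewrite <- INR_IZR_INZ in T1.
      replace ((- INR (S n)) ^ 2) with (INR (S n) ^ 2) in T2 by ring. unfold v. lra. }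
  replace (2 * B * Z2 * / (1 + IZR m ^ 2)) with (v * Z2) by (unfold v; ring).
  eapply Rle_trans; [apply (norm_sum_n_m (V := C_NormedModule))|].
  eapply Rle_trans; [apply sum_n_m_le; exact Hfold|].
  apply (sum_n_le_is_series (fun n => v * / (1 + INR n ^ 2)) (v * Z2) N).
  - intros n; apply Rmult_le_pos; [lra | specialize (Hpos n); lra].
  - exact (is_series_scal_l (V := R_NormedModule) v _ _ HZ).
Qed.

Lemma filterlim_lattice_term (m : Z) :
  filterlim (fun n => lattice_term m (- Z.of_nat n - 1)) eventually (locally (RtoC 0)).
Proof.
  destruct lattice_term_bound as [B [HB Hterm]].
  apply (filterlim_norm_zero (V := C_NormedModule)).
  assert (L := ex_series_lim_0 _ ex_series_inv_1_plus_sq). apply is_lim_seq_incr_1 in L.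
  apply (is_lim_seq_scal_l _ (B * / (1 + IZR m ^ 2))) in L.
  simpl in L. rewrite Rmult_0_r in L.
  apply is_lim_seq_le_le with (2 := is_lim_seq_const 0) (3 := L).
  intros n. split; [apply Cmod_ge_0|]. eapply Rle_trans; [apply Hterm|].
  rewrite minus_IZR, opp_IZR, <- INR_IZR_INZ.
  replace (- INR n - 1) with (- INR (S n)) by (rewrite S_INR; ring).
  replace ((- INR (S n)) ^ 2) with (INR (S n) ^ 2) by ring. apply Rle_refl.
Qed.

Lemma is_series_lattice_row (m : Z) :
  m <> 0%Z -> is_series (fold_opp (lattice_term m)) (phi (csc2 (column_point m))).
Proof.
  intros Hm. apply is_series_fold_opp; [|apply filterlim_lattice_term].
  assert (HP := PI_RGT_0). assert (Hz : column_point m <> 0).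
  { intros E. apply (f_equal Im) in E. simpl in E. apply not_0_IZR in Hm.
    assert (K := Rmult_integral (IZR m) y ltac:(lra)). lra. }
  apply is_series_ext with
    (2 := is_series_row p phi (column_point m) phi_row ltac:(simpl; lra) Hz).
  apply Z.eqb_neq in Hm. intros n. unfold fold_neg_pred, lattice_term. rewrite Hm. reflexivity.
Qed.

Definition even_inv_pow (x : R) : R := / x ^ (2 * p).

Lemma even_inv_pow_opp (x : R) : even_inv_pow (- x) = even_inv_pow x.
Proof. unfold even_inv_pow. rewrite !pow_mult. do 2 f_equal. ring. Qed.

Lemma even_inv_pow_double (x : R) : even_inv_pow (2 * x) = / 4 ^ p * even_inv_pow x.
Proof.
  unfold even_inv_pow. rewrite <- Rinv_mult, Rpow_mult_distr, (pow_mult 2).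
  do 3 f_equal. ring.
Qed.

Lemma even_inv_pow_RtoC (x : R) : x <> 0 -> (/ RtoC x ^ (2 * p))%C = RtoC (even_inv_pow x).
Proof.
  intros Hx. unfold even_inv_pow. rewrite RtoC_inv, RtoC_pow; auto. apply pow_nonzero; auto.
Qed.

Lemma lattice_term_0_l (n : Z) : n <> 0%Z -> lattice_term 0 n = RtoC (even_inv_pow (IZR n * PI)).
Proof.
  intros Hn. unfold lattice_term. rewrite (proj2 (Z.eqb_neq n 0) Hn). simpl andb. cbv iota.
  rewrite <- even_inv_pow_RtoC.
  - unfold column_point. rewrite Rmult_0_l, Ropp_0. fold (RtoC 0). rewrite Cplus_0_l. reflexivity.
  - apply Rmult_integral_contrapositive_currified; [apply not_0_IZR; auto | apply PI_neq0].
Qed.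

Lemma ex_series_even_inv_pow : ex_series (fun n => RtoC (even_inv_pow (INR (S n) * PI))).
Proof.
  destruct lattice_term_bound as [B [HB Hterm]].
  apply (ex_series_le (V := C_CompleteNormedModule) _ (fun n => B * / INR (S n) ^ 2)).
  - intros n. rewrite INR_IZR_INZ, <- lattice_term_0_l by lia.
    assert (HS : 0 < IZR (Z.of_nat (S n)) ^ 2) by (apply pow_lt, IZR_lt; lia).
    eapply Rle_trans; [apply Hterm|]. replace (1 + 0 ^ 2) with 1 by ring.
    rewrite Rinv_1, Rmult_1_r. apply Rmult_le_compat_l; [lra|]. apply Rinv_le_contravar; lra.
  - apply (ex_series_scal_l (V := R_NormedModule)), ex_series_inv_sq.
Qed.

Lemma four_pow_neq_0 : (4 ^ p)%C <> 0.
Proof. apply Cpow_nz; intros E; apply RtoC_inj in E; lra. Qed.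

(* The row through [PI / 2] consists of the terms of odd index of the zeta series. *)
Lemma is_series_odd_even_inv_pow :
  is_series (fun n => RtoC (even_inv_pow (INR (2 * n + 1) * PI))) (phi 1 / (2 * 4 ^ p))%C.
Proof.
  assert (HP := PI_RGT_0).
  assert (Hrow := is_series_row p phi (RtoC (PI / 2)) phi_row ltac:(simpl; lra)
    ltac:(intros E; apply RtoC_inj in E; lra)).
  replace (csc2 (RtoC (PI / 2))) with (RtoC 1) in Hrow by (unfold csc2; rewrite csin_PI2; field).
  apply (is_series_scal_l (V := C_NormedModule) (/ (2 * 4 ^ p))%C) in Hrow.
  replace (phi 1 / (2 * 4 ^ p))%C with (scal (/ (2 * 4 ^ p))%C (phi 1) : C)
    by (unfold scal; simpl; unfold mult; simpl; unfold Cdiv; ring).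
  apply is_series_ext with (2 := Hrow). intros n.
  unfold fold_neg_pred. rewrite <- !RtoC_plus, minus_IZR, opp_IZR, <- INR_IZR_INZ.
  set (x := INR (2 * n + 1) * PI).
  replace (PI / 2 + INR n * PI) with (x / 2)
    by (unfold x; rewrite plus_INR, mult_INR; simpl; field).
  replace (PI / 2 + (- INR n - 1) * PI) with (- (x / 2))
    by (unfold x; rewrite plus_INR, mult_INR; simpl; field).
  assert (Hx : 0 < x) by (apply Rmult_lt_0_compat; [apply lt_0_INR; lia | auto]).
  rewrite !even_inv_pow_RtoC, even_inv_pow_opp by lra.
  replace x with (2 * (x / 2)) at 3 by field. rewrite even_inv_pow_double.
  rewrite RtoC_mult, RtoC_inv, RtoC_pow by (apply pow_nonzero; lra).
  unfold scal; simpl; unfold mult; simpl. field. exact four_pow_neq_0.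
Qed.

Lemma four_pow_minus_1_neq_0 : (4 ^ p - 1)%C <> 0.
Proof.
  assert (H4 : 1 < 4 ^ p) by (apply Rlt_pow_R1; [lra | lia]).
  rewrite <- RtoC_pow, <- RtoC_minus. intros E; apply RtoC_inj in E; lra.
Qed.

Lemma is_series_even_inv_pow :
  is_series (fun n => RtoC (even_inv_pow (INR (S n) * PI))) (phi 1 / (2 * (4 ^ p - 1)))%C.
Proof.
  assert (Hsolve : forall x : C, x = (phi 1 / (2 * 4 ^ p) + / 4 ^ p * x)%C ->
    (phi 1 / (2 * (4 ^ p - 1)))%C = x).
  { intros x Hx. assert (N4 := four_pow_neq_0). assert (N41 := four_pow_minus_1_neq_0).
    transitivity ((x - / 4 ^ p * x) * (4 ^ p / (4 ^ p - 1)))%C; [|field; auto].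
    replace (x - / 4 ^ p * x)%C with (phi 1 / (2 * 4 ^ p))%C by (rewrite Hx at 1; ring).
    field; auto. }
  destruct ex_series_even_inv_pow as [l Hl].
  rewrite (Hsolve l); [exact Hl|].
  apply (filterlim_locally_unique (V := C_NormedModule) _ _ _ (is_series_even_odd _ _ Hl)).
  apply is_series_ext with (2 := is_series_plus (V := C_NormedModule) _ _ _ _
    is_series_odd_even_inv_pow (is_series_scal_l (V := C_NormedModule) (/ 4 ^ p)%C _ _ Hl)).
  intros n. apply (f_equal2 Cplus).
  - do 4 f_equal. lia.
  - change (/ 4 ^ p * RtoC (even_inv_pow (INR (S n) * PI))
      = RtoC (even_inv_pow (INR (S (2 * n + 1)) * PI)))%C.
    rewrite <- RtoC_pow, <- RtoC_inv by (apply pow_nonzero; lra).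
    rewrite <- RtoC_mult, <- even_inv_pow_double. do 2 f_equal.
    rewrite !S_INR, plus_INR, mult_INR; simpl; ring.
Qed.

Lemma is_series_lattice_row_0 : is_series (fold_opp (lattice_term 0)) (phi 1 / (4 ^ p - 1))%C.
Proof.
  apply (is_series_decr_1 (V := C_NormedModule)).
  assert (Hz := is_series_even_inv_pow).
  apply (is_series_scal_l (V := C_NormedModule) (RtoC 2)) in Hz.
  apply is_series_ext with (fun n => scal (RtoC 2) (RtoC (even_inv_pow (INR (S n) * PI)))).
  - intros n. unfold fold_opp. rewrite !lattice_term_0_l by lia.
    rewrite opp_IZR, <- INR_IZR_INZ, <- Ropp_mult_distr_l, even_inv_pow_opp.
    unfold scal; simpl; unfold mult; simpl. ring.
  - assert (E : (2 * (phi 1 / (2 * (4 ^ p - 1))) = phi 1 / (4 ^ p - 1) + - 0)%C)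
      by (field; exact four_pow_minus_1_neq_0).
    replace (plus _ _) with (2 * (phi 1 / (2 * (4 ^ p - 1))))%C by exact E. exact Hz.
Qed.

Definition row_value (m : Z) : C :=
  if Z.eqb m 0 then (phi 1 / (4 ^ p - 1))%C else phi (csc2 (column_point m)).

Lemma filterlim_row_partial (m : Z) :
  filterlim (fun N => row_partial N m) eventually (locally (row_value m)).
Proof.
  unfold row_value. destruct (Z.eqb_spec m 0) as [->|Hm].
  - exact is_series_lattice_row_0.
  - exact (is_series_lattice_row m Hm).
Qed.

Lemma is_series_fold_opp_row_value (L : C) :
  is_series (fun m => phi (csc2 (column_point (Z.of_nat (S m))))) L ->
  is_series (fold_opp row_value) (phi 1 / (4 ^ p - 1) + 2 * L)%C.
Proof.
  intros HL. apply (is_series_decr_1 (V := C_NormedModule)).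
  apply (is_series_scal_l (V := C_NormedModule) (RtoC 2)) in HL.
  apply is_series_ext with
    (fun m => scal (RtoC 2) (phi (csc2 (column_point (Z.of_nat (S m)))))).
  - intros m. unfold fold_opp, row_value. rewrite !(proj2 (Z.eqb_neq _ 0)) by lia.
    replace (column_point (- Z.of_nat (S m))) with (- column_point (Z.of_nat (S m)))%C.
    + rewrite csc2_opp. unfold scal; simpl; unfold mult; simpl. ring.
    + unfold column_point, Copp. rewrite opp_IZR. simpl. f_equal; ring.
  - assert (E : (2 * L = phi 1 / (4 ^ p - 1) + 2 * L + - (phi 1 / (4 ^ p - 1)))%C) by ring.
    replace (plus _ _) with (2 * L)%C by exact E. exact HL.
Qed.

Lemma fold_opp_row_partial_bound :
  exists B : R, 0 < B /\ forall N m : nat,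
    Cmod (fold_opp (row_partial N) m) <= B * / (1 + INR m ^ 2).
Proof.
  destruct row_partial_bound as [B [HB Hbound]]. exists (2 * B). split; [lra|]. intros N m.
  assert (Hm := inv_1_plus_sq_pos (INR m)).
  assert (Hpos := Hbound N (Z.of_nat m)). assert (Hneg := Hbound N (- Z.of_nat m)%Z).
  rewrite opp_IZR, <- INR_IZR_INZ in Hneg. rewrite <- INR_IZR_INZ in Hpos.
  replace ((- INR m) ^ 2) with (INR m ^ 2) in Hneg by ring.
  destruct m as [|m]; unfold fold_opp.
  - eapply Rle_trans; [exact Hpos | nra].
  - eapply Rle_trans; [apply Cmod_triangle | lra].
Qed.

Lemma filterlim_lattice_sum (L : C) :
  is_series (fun m => phi (csc2 (column_point (Z.of_nat (S m))))) L ->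
  filterlim (fun N => sum_n (fold_opp (row_partial N)) N) eventually
    (locally (phi 1 / (4 ^ p - 1) + 2 * L)%C).
Proof.
  intros HL. destruct fold_opp_row_partial_bound as [B [HB Hbound]].
  set (a N m := if Nat.leb m N then fold_opp (row_partial N) m else RtoC 0).
  destruct (filterlim_series_dominated (F := eventually) (V := C_CompleteNormedModule)
    a (fun N => sum_n (fold_opp (row_partial N)) N) (fold_opp row_value)
    (fun m => B * / (1 + INR m ^ 2))) as [T [HT HT']].
  - apply (ex_series_scal_l (V := R_NormedModule)), ex_series_inv_1_plus_sq.
  - apply filter_forall; intros N; split.
    + replace (sum_n (fold_opp (row_partial N)) N) with (sum_n (a N) N).
      * apply (is_series_finite_support (V := C_NormedModule)). intros m Hm. unfold a.
        destruct (Nat.leb_spec m N); [lia | reflexivity].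
      * apply sum_n_ext_loc; intros m Hm. unfold a.
        destruct (Nat.leb_spec m N); [reflexivity | lia].
    + intros m. change (Cmod (a N m) <= B * / (1 + INR m ^ 2)). unfold a.
      destruct (Nat.leb m N); [apply Hbound|].
      rewrite Cmod_0. apply Rmult_le_pos; [lra | left; apply inv_1_plus_sq_pos].
  - intros m. apply filterlim_ext_loc with (fun N => fold_opp (row_partial N) m).
    { exists m; intros N HN. unfold a. destruct (Nat.leb_spec m N); [reflexivity | lia]. }
    destruct m as [|m]; [|apply filterlim_Cplus]; apply filterlim_row_partial.
  - replace (phi 1 / (4 ^ p - 1) + 2 * L)%C with T; [exact HT'|].
    exact (filterlim_locally_unique (V := C_NormedModule) _ _ _ HT
      (is_series_fold_opp_row_value L HL)).
Qed.

End Lattice.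

Lemma eis_partial_rectangular (p : nat) (Om s : R) (N : nat) :
  0 < Om -> 0 < s ->
  eis_partial (2 * p) (Om, 0) (0, s) N
  = (/ ((0, (2 * s / PI)%R) : C) ^ (2 * p)
     * sum_n (fold_opp (row_partial (PI * Om / s)%R p N)) N)%C.
Proof.
  intros HOm Hs. assert (HP := PI_RGT_0). set (y := PI * Om / s).
  assert (Hy : 0 < y) by (apply Rdiv_lt_0_compat; [apply Rmult_lt_0_compat|]; auto).
  set (u := (0, 2 * s / PI) : C).
  assert (Hu : u <> 0).
  { intros E. apply (f_equal Im) in E. simpl in E.
    assert (0 < 2 * s / PI) by (apply Rdiv_lt_0_compat; lra). lra. }
  assert (Hterm : forall m n : Z,
    (if (Z.eqb m 0 && Z.eqb n 0)%bool then RtoC 0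
     else / lattice_pt (Om, 0%R) (0%R, s) m n ^ (2 * p))%C
    = (/ u ^ (2 * p) * lattice_term y p m n)%C).
  { intros m n. unfold lattice_term.
    destruct (Z.eqb m 0 && Z.eqb n 0)%bool eqn:E; [ring|].
    apply Bool.andb_false_iff in E. rewrite !Z.eqb_neq in E.
    assert (Hw := lattice_point_neq_0 y Hy m n E).
    replace (lattice_pt (Om, 0) (0, s) m n) with (u * (column_point y m + RtoC (IZR n * PI)))%C.
    - rewrite Cpow_mult_l. field. split; apply Cpow_nz; auto.
    - unfold lattice_pt, column_point, u, y, Cplus, Cmult, RtoC; simpl. f_equal; field; lra. }
  unfold eis_partial. rewrite fold_right_Cplus_flat_map, fold_right_Cplus_zrange.
  rewrite <- (sum_n_scal_l (V := C_ModuleSpace)). apply sum_n_ext; intros m.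
  transitivity (fold_opp (fun m => / u ^ (2 * p) * row_partial y p N m)%C m);
    [|apply fold_opp_scal].
  apply fold_opp_ext; clear m; intros m.
  rewrite fold_right_Cplus_zrange. unfold row_partial.
  rewrite <- (sum_n_scal_l (V := C_ModuleSpace)). apply sum_n_ext; intros n.
  transitivity (fold_opp (fun n => / u ^ (2 * p) * lattice_term y p m n)%C n);
    [|apply fold_opp_scal].
  apply fold_opp_ext; intros; apply Hterm.
Qed.

Ltac rewrite_derive D :=
  match type of D with is_derive ?f ?x ?l =>
    try change (Derive (fun t => f t) x) with (Derive f x);
    rewrite (is_derive_unique f x l D)
  end.

Definition koebe (w : R) : R := w / (1 - w) ^ 2.

Lemma is_series_INR_pow_geom_S (j : nat) (g g' : R -> R) :
  (forall w, Rabs w < 1 -> is_series (fun n => INR n ^ j * w ^ n) (g w)) ->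
  (forall w, Rabs w < 1 -> is_derive g w (g' w)) ->
  forall w, Rabs w < 1 -> is_series (fun n => INR n ^ S j * w ^ n) (w * g' w).
Proof.
  intros Hg Hg' w Hw. set (a n := INR n ^ j).
  assert (Hrad : Rbar_lt (Rabs w) (CV_radius a)).
  { apply Rbar_lt_le_trans with 1; [exact Hw | apply CV_radius_INR_pow]. }
  assert (E : PSeries (PS_derive a) w = g' w).
  { rewrite <- (is_derive_unique _ _ _ (is_derive_PSeries _ _ Hrad)).
    apply is_derive_unique, is_derive_ext_loc with (2 := Hg' w Hw).
    assert (Hopen : open (fun z => Rabs z < 1)).
    { apply (open_comp Rabs (fun z => z < 1)); [|apply open_lt].
      intros z _. apply (filterlim_norm (V := R_NormedModule)). }
    generalize (Hopen w Hw). apply filter_imp; intros z Hz.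
    symmetry; apply is_series_unique, Hg, Hz. }
  rewrite <- E, <- PSeries_incr_1.
  apply is_series_ext with (fun n => PS_incr_1 (PS_derive a) n * w ^ n).
  - intros n; rewrite PS_incr_derive; reflexivity.
  - apply is_series_PSeries. rewrite CV_radius_incr_1, CV_radius_derive; exact Hrad.
Qed.

Lemma is_series_INR_geom (w : R) : Rabs w < 1 -> is_series (fun n => INR n ^ 1 * w ^ n) (koebe w).
Proof.
  intros Hw. unfold koebe, Rdiv. revert w Hw.
  apply (is_series_INR_pow_geom_S 0 (fun w => / (1 - w))).
  - intros w Hw. apply is_series_ext with (2 := is_series_geom w Hw). intros; simpl; ring.
  - intros w Hw. apply Rabs_def2 in Hw. auto_derive; [lra | field; lra].
Qed.

Lemma is_derive_koebe (w : R) : Rabs w < 1 -> is_derive koebe w ((1 + w) / (1 - w) ^ 3).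
Proof.
  intros Hw. apply Rabs_def2 in Hw. unfold koebe. auto_derive.
  - apply Rmult_integral_contrapositive_currified; lra.
  - field; lra.
Qed.

Lemma is_series_INR_cube_geom (w : R) :
  Rabs w < 1 -> is_series (fun n => INR n ^ 3 * w ^ n) (koebe w + 6 * koebe w ^ 2).
Proof.
  intros Hw.
  assert (S2 := is_series_INR_pow_geom_S 1 koebe _ is_series_INR_geom is_derive_koebe).
  assert (S3 := is_series_INR_pow_geom_S 2 _ (fun v => (1 + 4 * v + v ^ 2) / (1 - v) ^ 4) S2).
  replace (koebe w + 6 * koebe w ^ 2) with (w * ((1 + 4 * w + w ^ 2) / (1 - w) ^ 4)).
  - apply S3; [|exact Hw]. intros v Hv. apply Rabs_def2 in Hv. auto_derive; [|field; lra].
    repeat split; repeat apply Rmult_integral_contrapositive_currified; lra.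
  - apply Rabs_def2 in Hw. unfold koebe. field; lra.
Qed.

Lemma is_series_INR_fifth_geom (w : R) :
  Rabs w < 1 ->
  is_series (fun n => INR n ^ 5 * w ^ n) (koebe w + 30 * koebe w ^ 2 + 120 * koebe w ^ 3).
Proof.
  intros Hw.
  assert (S4 := is_series_INR_pow_geom_S 3 (fun v => koebe v + 6 * koebe v ^ 2)
    (fun v => (1 + 12 * koebe v) * ((1 + v) / (1 - v) ^ 3)) is_series_INR_cube_geom).
  assert (D : forall v, Rabs v < 1 -> is_derive (fun v => koebe v + 6 * koebe v ^ 2) v
    ((1 + 12 * koebe v) * ((1 + v) / (1 - v) ^ 3))).
  { intros v Hv. assert (Dk := is_derive_koebe v Hv).
    auto_derive; [repeat split; eexists; exact Dk|].
    rewrite_derive Dk. ring. }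
  assert (S5 := is_series_INR_pow_geom_S 4 _
    (fun v => (1 + 26 * v + 66 * v ^ 2 + 26 * v ^ 3 + v ^ 4) / (1 - v) ^ 6) (S4 D)).
  replace (koebe w + _ + _)
    with (w * ((1 + 26 * w + 66 * w ^ 2 + 26 * w ^ 3 + w ^ 4) / (1 - w) ^ 6)).
  - apply S5; [|exact Hw]. intros v Hv. apply Rabs_def2 in Hv. unfold koebe.
    auto_derive; [|field; lra].
    repeat split; repeat apply Rmult_integral_contrapositive_currified; lra.
  - apply Rabs_def2 in Hw. unfold koebe. field; lra.
Qed.

Lemma csc2_imaginary (t : R) : 0 < t -> csc2 (0, - t) = RtoC (-4 * koebe (exp (- (2 * t)))).
Proof.
  intros Ht. destruct (exp_neg_bounds (2 * t) ltac:(lra)) as [Hw0 Hw1].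
  assert (Hsinh : sinh t ^ 2 = (1 - exp (- (2 * t))) ^ 2 / (4 * exp (- (2 * t)))).
  { assert (Hv := exp_pos (- t)). unfold sinh.
    replace (exp (- (2 * t))) with (exp (- t) * exp (- t))
      by (rewrite <- exp_plus; f_equal; ring).
    replace (exp t) with (/ exp (- t)) by (rewrite <- exp_Ropp; f_equal; ring).
    field; lra. }
  unfold csc2, koebe. set (w := exp (- (2 * t))) in *.
  replace (csin (0, (- t)%R) ^ 2)%C with (RtoC (- ((1 - w) ^ 2 / (4 * w)))).
  - rewrite <- RtoC_inv; [f_equal; field; lra|].
    assert (0 < (1 - w) ^ 2 / (4 * w)) by (apply Rdiv_lt_0_compat; [apply pow_lt|]; lra). lra.
  - rewrite <- Hsinh. unfold csin, Cpow, Cmult, RtoC; simpl.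
    rewrite sin_0, cos_0. unfold sinh. rewrite Ropp_involutive. f_equal; field.
Qed.

Lemma is_eisenstein_rectangular (p : nat) (phi : C -> C) (Om s : R) (L : C) :
  row_polynomial p phi -> (2 <= p)%nat -> 0 < Om -> 0 < s ->
  is_series (fun m => phi (RtoC (-4 * koebe (exp (- (INR (S m) * (2 * (PI * Om / s)))))))) L ->
  is_eisenstein (2 * p) (Om, 0) (0, s)
    (/ ((0, (2 * s / PI)%R) : C) ^ (2 * p) * (phi 1 / (4 ^ p - 1) + 2 * L))%C.
Proof.
  intros Hphi Hp HOm Hs HL. assert (HP := PI_RGT_0).
  assert (Hy : 0 < PI * Om / s) by (apply Rdiv_lt_0_compat; [apply Rmult_lt_0_compat|]; auto).
  apply filterlim_ext with (1 := fun N => eq_sym (eis_partial_rectangular p Om s N HOm Hs)).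
  apply filterlim_Cmult; [apply filterlim_const|].
  apply filterlim_lattice_sum; auto.
  apply is_series_ext with (2 := HL). intros m. f_equal.
  unfold column_point. rewrite <- INR_IZR_INZ.
  rewrite csc2_imaginary by (apply Rmult_lt_0_compat; [apply lt_0_INR; lia | exact Hy]).
  do 5 f_equal. ring.
Qed.

Lemma row_quartic_RtoC (x : R) : row_quartic (RtoC x) = RtoC (x ^ 2 - 2 / 3 * x).
Proof.
  unfold row_quartic. rewrite RtoC_minus, RtoC_mult, RtoC_div, RtoC_pow by lra. reflexivity.
Qed.

Lemma row_sextic_RtoC (x : R) : row_sextic (RtoC x) = RtoC (x ^ 3 - x ^ 2 + 2 / 15 * x).
Proof.
  unfold row_sextic.
  rewrite RtoC_plus, RtoC_minus, RtoC_mult, RtoC_div, !RtoC_pow by lra. reflexivity.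
Qed.

Lemma is_series_row_quartic_koebe (h : R) :
  0 < h ->
  is_series (fun m => row_quartic (RtoC (-4 * koebe (exp (- (INR (S m) * h))))))
    (RtoC (8 / 3 * lambert 1 3 h)).
Proof.
  intros Hh. assert (HL := is_series_lambert_rows 2 _ h Hh is_series_INR_cube_geom).
  apply (is_series_scal_l (V := R_NormedModule) (8 / 3)), is_series_RtoC in HL.
  apply is_series_ext with (2 := HL). intros m. rewrite row_quartic_RtoC. f_equal.
  unfold scal; simpl; unfold mult; simpl. field.
Qed.

Lemma is_series_row_sextic_koebe (h : R) :
  0 < h ->
  is_series (fun m => row_sextic (RtoC (-4 * koebe (exp (- (INR (S m) * h))))))
    (RtoC (- (8 / 15) * lambert 1 5 h)).
Proof.
  intros Hh. assert (HL := is_series_lambert_rows 4 _ h Hh is_series_INR_fifth_geom).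
  apply (is_series_scal_l (V := R_NormedModule) (- (8 / 15))), is_series_RtoC in HL.
  apply is_series_ext with (2 := HL). intros m. rewrite row_sextic_RtoC. f_equal.
  unfold scal; simpl; unfold mult; simpl. field.
Qed.

Lemma Cinv_imaginary_pow (r : R) (p : nat) :
  r <> 0 -> (/ ((0, r) : C) ^ (2 * p))%C = RtoC (/ (- r ^ 2) ^ p).
Proof.
  intros Hr. rewrite Cpow_mult_r, RtoC_inv, RtoC_pow.
  - do 2 f_equal. unfold Cpow, Cmult, RtoC; simpl. f_equal; ring.
  - apply pow_nonzero, Ropp_neq_0_compat, pow_nonzero, Hr.
Qed.

Lemma invariants_rectangular (Om s g2 g3 : R) :
  0 < Om -> 0 < s -> has_invariants (Om, 0) (0, s) g2 g3 ->
  let h := 2 * (PI * Om / s) in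
  g2 / 60 = (PI / (2 * s)) ^ 4 * (eisE4 h / 45) /\
  g3 / 140 = - (PI / (2 * s)) ^ 6 * (2 / 945 * eisE6 h).
Proof.
  intros HOm Hs [H4 H6] h. assert (HP := PI_RGT_0).
  assert (Hh : 0 < h).
  { apply Rmult_lt_0_compat; [lra|]. apply Rdiv_lt_0_compat; [apply Rmult_lt_0_compat|]; auto. }
  assert (Hu : 2 * s / PI <> 0) by (apply Rgt_not_eq, Rdiv_lt_0_compat; lra).
  assert (Hunique : forall k (a b : C),
    is_eisenstein k (Om, 0) (0, s) a -> is_eisenstein k (Om, 0) (0, s) b -> a = b).
  { intros k a b. exact (filterlim_locally_unique (V := C_NormedModule) _ a b). }
  assert (E4 := Hunique 4%nat _ _ H4 (is_eisenstein_rectangular 2 row_quartic Om s _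
    row_polynomial_quartic (le_n 2) HOm Hs (is_series_row_quartic_koebe h Hh))).
  assert (E6 := Hunique 6%nat _ _ H6 (is_eisenstein_rectangular 3 row_sextic Om s _
    row_polynomial_sextic (le_S _ _ (le_n 2)) HOm Hs (is_series_row_sextic_koebe h Hh))).
  rewrite Cinv_imaginary_pow in E4, E6 by exact Hu.
  rewrite row_quartic_RtoC in E4. rewrite row_sextic_RtoC in E6.
  rewrite <- RtoC_pow, <- RtoC_minus, <- RtoC_div, <- !RtoC_mult, <- RtoC_plus, <- RtoC_mult
    in E4, E6 by lra.
  apply RtoC_inj in E4. apply RtoC_inj in E6. rewrite E4, E6. unfold eisE4, eisE6.
  split; field; lra.
Qed.

(** * The hypergeometric equation *)

Lemma pochhammer_pos (a : R) (n : nat) : 0 < a -> 0 < pochhammer a n.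
Proof.
  intros Ha; induction n as [|n IH]; simpl; [lra|].
  apply Rmult_lt_0_compat; auto. assert (K := pos_INR n); lra.
Qed.

Section Hypergeometric.
Variables a b c : R.
Hypothesis a_pos : 0 < a.
Hypothesis b_pos : 0 < b.
Hypothesis c_pos : 0 < c.

Definition hyp_coef (n : nat) : R :=
  pochhammer a n * pochhammer b n / (pochhammer c n * INR (fact n)).

Definition hyp2F1' (x : R) : R := PSeries (PS_derive hyp_coef) x.
Definition hyp2F1'' (x : R) : R := PSeries (PS_derive (PS_derive hyp_coef)) x.

Lemma hyp_coef_pos (n : nat) : 0 < hyp_coef n.
Proof.
  apply Rdiv_lt_0_compat; apply Rmult_lt_0_compat; try apply pochhammer_pos; auto.
  apply INR_fact_lt_0.
Qed.

Lemma hyp_coef_S (n : nat) :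
  hyp_coef (S n) * ((c + INR n) * (INR n + 1)) = hyp_coef n * ((a + INR n) * (b + INR n)).
Proof.
  unfold hyp_coef. cbn [pochhammer].
  replace (INR (fact (S n))) with ((INR n + 1) * INR (fact n))
    by (rewrite <- S_INR, <- mult_INR; reflexivity).
  assert (Hc := pochhammer_pos c n c_pos). assert (Hf := INR_fact_lt_0 n).
  assert (K := pos_INR n). field. repeat split; lra.
Qed.

Lemma is_lim_seq_shift_ratio (r s : R) :
  0 < s -> is_lim_seq (fun n => (r + INR n) / (s + INR n)) 1.
Proof.
  intros Hs.
  apply is_lim_seq_ext with (fun n => 1 + (r - s) * / (s + INR n)).
  { intros n. assert (K := pos_INR n). field. lra. }
  replace (Finite 1) with (Finite (1 + (r - s) * 0)) by (f_equal; ring).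
  apply is_lim_seq_plus'; [apply is_lim_seq_const|].
  apply is_lim_seq_mult'; [apply is_lim_seq_const|].
  apply (is_lim_seq_inv _ p_infty); [|discriminate].
  apply is_lim_seq_plus with s p_infty;
    [apply is_lim_seq_const | apply is_lim_seq_INR | reflexivity].
Qed.

Lemma CV_radius_hyp_coef : CV_radius hyp_coef = 1.
Proof.
  rewrite <- Rinv_1. apply CV_radius_finite_DAlembert; [|lra|].
  - intros n. assert (K := hyp_coef_pos n). lra.
  - apply is_lim_seq_ext with
      (fun n => (a + INR n) / (c + INR n) * ((b + INR n) / (1 + INR n))).
    + intros n. assert (K := pos_INR n).
      assert (H0 := hyp_coef_pos n). assert (HS := hyp_coef_pos (S n)).
      rewrite Rabs_pos_eq by (left; apply Rdiv_lt_0_compat; auto).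
      apply Rmult_eq_reg_r with (hyp_coef n * ((c + INR n) * (INR n + 1)));
        [|apply Rgt_not_eq, Rmult_lt_0_compat; [|apply Rmult_lt_0_compat]; lra].
      transitivity (hyp_coef n * ((a + INR n) * (b + INR n))); [field; lra|].
      rewrite <- hyp_coef_S. field. lra.
    + replace (Finite 1) with (Finite (1 * 1)) by (f_equal; ring).
      apply is_lim_seq_mult'; apply is_lim_seq_shift_ratio; lra.
Qed.

Lemma hyp_coef_radius (x : R) : Rabs x < 1 -> Rbar_lt (Rabs x) (CV_radius hyp_coef).
Proof. intros Hx. rewrite CV_radius_hyp_coef. exact Hx. Qed.

Lemma is_derive_hyp2F1 (x : R) : Rabs x < 1 -> is_derive (hyp2F1 a b c) x (hyp2F1' x).
Proof. intros Hx. exact (is_derive_PSeries hyp_coef x (hyp_coef_radius x Hx)). Qed.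

Lemma is_derive_hyp2F1' (x : R) : Rabs x < 1 -> is_derive hyp2F1' x (hyp2F1'' x).
Proof.
  intros Hx. apply is_derive_PSeries. rewrite CV_radius_derive. apply hyp_coef_radius; auto.
Qed.

Lemma hyp2F1_0 : hyp2F1 a b c 0 = 1.
Proof. change (PSeries hyp_coef 0 = 1). rewrite PSeries_0. unfold hyp_coef; simpl. field. Qed.

Lemma hyp2F1_pos (x : R) : 0 <= x < 1 -> 0 < hyp2F1 a b c x.
Proof.
  intros Hx.
  assert (HF : is_series (fun n => hyp_coef n * x ^ n) (hyp2F1 a b c x)).
  { apply (is_series_PSeries hyp_coef), hyp_coef_radius. rewrite Rabs_pos_eq; lra. }
  assert (Hterm : forall n, 0 <= hyp_coef n * x ^ n).
  { intros n. apply Rmult_le_pos; [left; apply hyp_coef_pos | apply pow_le; lra]. }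
  assert (H := proj2 (sum_n_le_is_series _ _ 0 Hterm HF)).
  rewrite sum_O in H. simpl in H. assert (K := hyp_coef_pos 0). lra.
Qed.

Lemma hypergeometric_equation (x : R) : Rabs x < 1 ->
  x * (1 - x) * hyp2F1'' x + (c - (a + b + 1) * x) * hyp2F1' x - a * b * hyp2F1 a b c x = 0.
Proof.
  intros Hx. assert (R0 := hyp_coef_radius x Hx).
  set (u := hyp_coef) in *. set (d1 := PS_derive u). set (d2 := PS_derive d1).
  assert (R1 : Rbar_lt (Rabs x) (CV_radius d1)) by (unfold d1; rewrite CV_radius_derive; auto).
  assert (R2 : Rbar_lt (Rabs x) (CV_radius d2)) by (unfold d2; rewrite CV_radius_derive; auto).
  assert (Sxd2 := is_series_PSeries (PS_incr_1 d2) x ltac:(rewrite CV_radius_incr_1; auto)).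
  assert (Sxxd2 := is_series_PSeries (PS_incr_1 (PS_incr_1 d2)) x
    ltac:(rewrite !CV_radius_incr_1; auto)).
  assert (Sxd1 := is_series_PSeries (PS_incr_1 d1) x ltac:(rewrite CV_radius_incr_1; auto)).
  assert (Sd1 := is_series_PSeries d1 x R1). assert (Su := is_series_PSeries u x R0).
  rewrite PSeries_incr_1 in Sxd1, Sxd2. rewrite 2 PSeries_incr_1 in Sxxd2.
  change (PSeries d1 x) with (hyp2F1' x) in *. change (PSeries d2 x) with (hyp2F1'' x) in *.
  change (PSeries u x) with (hyp2F1 a b c x) in *.
  assert (Sum := is_series_minus _ _ _ _
    (is_series_plus _ _ _ _ (is_series_minus _ _ _ _ Sxd2 Sxxd2) (is_series_scal_l c _ _ Sd1))
    (is_series_plus _ _ _ _ (is_series_scal_l (a + b + 1) _ _ Sxd1)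
       (is_series_scal_l (a * b) _ _ Su))).
  assert (Series_0 : Series (fun _ => 0) = 0).
  { apply is_series_unique. exact (is_series_zero (V := R_NormedModule)). }
  apply is_series_unique in Sum. revert Sum. rewrite (Series_ext _ (fun _ => 0)), Series_0.
  - unfold minus, plus, opp, scal; simpl; unfold mult; simpl. intros E. lra.
  - intros n.
    assert (Ed1 : d1 n = (INR n + 1) * u (S n)) by (rewrite <- S_INR; reflexivity).
    assert (Exd1 : PS_incr_1 d1 n = INR n * u n) by apply PS_incr_derive.
    assert (Exd2 : PS_incr_1 d2 n = INR n * d1 n) by apply PS_incr_derive.
    assert (Exxd2 : PS_incr_1 (PS_incr_1 d2) n = INR n * (INR n - 1) * u n :> R).
    { destruct n as [|n]; [simpl; unfold zero; simpl; ring|].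
      change (PS_incr_1 d2 n = INR (S n) * (INR (S n) - 1) * u (S n) :> R).
      unfold d2. rewrite PS_incr_derive. unfold d1, PS_derive. rewrite S_INR; ring. }
    rewrite Exd2, Exxd2, Exd1, Ed1.
    unfold minus, plus, opp, scal; simpl; unfold mult; simpl.
    transitivity ((u (S n) * ((c + INR n) * (INR n + 1)) - u n * ((a + INR n) * (b + INR n)))
      * x ^ n); [ring|].
    unfold u. rewrite hyp_coef_S. ring.
Qed.

End Hypergeometric.

(** * The cubic parametrization *)

(* With [x = 9/8 (1 - t^2)], this is [(1 - 4x/3 + 8x^2/27) / (1 - 8x/9)^(3/2)]. *)
Definition cubic_ratio (t : R) : R := (3 * t ^ 4 + 6 * t ^ 2 - 1) / (8 * t ^ 3).

Lemma cubic_ratio_increasing (s t : R) : 0 < s -> s < t -> cubic_ratio s < cubic_ratio t.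
Proof.
  intros Hs Hst. apply Rlt_0_minus.
  replace (cubic_ratio t - cubic_ratio s) with
    ((t - s) * (3 / 8 * (1 - / (s * t)) ^ 2 + (t - s) ^ 2 / (8 * (s * t) ^ 3)))
    by (unfold cubic_ratio; field; lra).
  apply Rmult_lt_0_compat; [lra|]. apply Rplus_le_lt_0_compat.
  - assert (K := pow2_ge_0 (1 - / (s * t))). lra.
  - assert (0 < s * t) by (apply Rmult_lt_0_compat; lra).
    apply Rdiv_lt_0_compat; [apply pow_lt; lra|].
    apply Rmult_lt_0_compat; [lra | apply pow_lt; auto].
Qed.

Lemma cubic_ratio_surjective (r : R) : {t : R | 0 < t /\ cubic_ratio t = r}.
Proof.
  set (T := 1 + 8 / 3 * Rabs r). assert (Hr := Rabs_pos r). assert (Hr' := Rle_abs r).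
  destruct (IVT (fun t => 3 * t ^ 4 - 8 * r * t ^ 3 + 6 * t ^ 2 - 1) 0 T) as [t [Ht E]].
  - intros t. apply derivable_continuous_pt. reg.
  - unfold T; lra.
  - simpl; lra.
  - assert (HT : 1 <= T) by (unfold T; lra).
    assert (H2 : 1 <= T ^ 2) by (apply pow_R1_Rle; auto).
    assert (H3 : 0 <= T ^ 3 * (3 * T - 8 * r)).
    { apply Rmult_le_pos; [apply pow_le; lra | unfold T; lra]. }
    replace (3 * T ^ 4 - 8 * r * T ^ 3 + 6 * T ^ 2 - 1)
      with (T ^ 3 * (3 * T - 8 * r) + 6 * T ^ 2 - 1) by ring. lra.
  - assert (t <> 0) by (intros ->; simpl in E; lra).
    exists t. split; [lra|]. unfold cubic_ratio.
    replace (3 * t ^ 4 + 6 * t ^ 2 - 1) with (8 * r * t ^ 3) by lra. field; auto.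
Qed.

Definition cubic_ratio_inv (r : R) : R := proj1_sig (cubic_ratio_surjective r).

Lemma cubic_ratio_inv_pos (r : R) : 0 < cubic_ratio_inv r.
Proof. exact (proj1 (proj2_sig (cubic_ratio_surjective r))). Qed.

Lemma cubic_ratio_invK (r : R) : cubic_ratio (cubic_ratio_inv r) = r.
Proof. exact (proj2 (proj2_sig (cubic_ratio_surjective r))). Qed.

Lemma cubic_ratioK (t : R) : 0 < t -> cubic_ratio_inv (cubic_ratio t) = t.
Proof.
  intros Ht. assert (Hs := cubic_ratio_inv_pos (cubic_ratio t)).
  assert (E := cubic_ratio_invK (cubic_ratio t)).
  destruct (Rtotal_order (cubic_ratio_inv (cubic_ratio t)) t) as [H|[H|H]]; auto.
  - assert (K := cubic_ratio_increasing _ _ Hs H). lra.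
  - assert (K := cubic_ratio_increasing _ _ Ht H). lra.
Qed.

Lemma cubic_ratio_inv_lt (r t : R) : 0 < t -> r < cubic_ratio t -> cubic_ratio_inv r < t.
Proof.
  intros Ht Hr. apply Rnot_le_lt; intros H. rewrite <- (cubic_ratio_invK r) in Hr.
  destruct H as [H|H]; [assert (K := cubic_ratio_increasing _ _ Ht H) | subst t]; lra.
Qed.

Lemma cubic_ratio_inv_gt (r t : R) : 0 < t -> cubic_ratio t < r -> t < cubic_ratio_inv r.
Proof.
  intros Ht Hr. apply Rnot_le_lt; intros H. rewrite <- (cubic_ratio_invK r) in Hr.
  assert (Hs := cubic_ratio_inv_pos r).
  destruct H as [H|H]; [assert (K := cubic_ratio_increasing _ _ Hs H) | rewrite H in Hr]; lra.
Qed.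

Lemma is_derive_cubic_ratio (t : R) :
  0 < t -> is_derive cubic_ratio t (3 * (1 - t ^ 2) ^ 2 / (8 * t ^ 4)).
Proof.
  intros Ht. unfold cubic_ratio. auto_derive; [|field; lra].
  repeat apply Rmult_integral_contrapositive_currified; lra.
Qed.

Lemma is_derive_continuity_pt (f : R -> R) (x l : R) : is_derive f x l -> continuity_pt f x.
Proof. intros H. apply derivable_continuous_pt, ex_derive_Reals_0. exists l; exact H. Qed.

Lemma continuity_pt_cubic_ratio_inv (r : R) : continuity_pt cubic_ratio_inv r.
Proof.
  set (t := cubic_ratio_inv r). assert (Ht : 0 < t) by apply cubic_ratio_inv_pos.
  apply (continuity_pt_recip_prelim cubic_ratio cubic_ratio_inv (t / 2) (t + 1)).
  - lra.
  - intros u v Hu Huv _. apply cubic_ratio_increasing; lra.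
  - intros u Hu. apply (cubic_ratioK u); lra.
  - intros u Hu. apply (is_derive_continuity_pt _ _ _ (is_derive_cubic_ratio u ltac:(lra))).
  - replace r with (cubic_ratio t) by apply cubic_ratio_invK.
    split; apply cubic_ratio_increasing; lra.
Qed.

Lemma is_derive_cubic_ratio_inv (r : R) :
  let t := cubic_ratio_inv r in
  t <> 1 -> is_derive cubic_ratio_inv r (/ (3 * (1 - t ^ 2) ^ 2 / (8 * t ^ 4))).
Proof.
  intros t Ht1. assert (Ht : 0 < t) by apply cubic_ratio_inv_pos.
  assert (Hmono : forall u v, u < v -> cubic_ratio_inv u < cubic_ratio_inv v).
  { intros u v Huv. apply cubic_ratio_inv_lt; [apply cubic_ratio_inv_pos|].
    rewrite cubic_ratio_invK; auto. }
  assert (Hder : forall u, cubic_ratio_inv (r - 1) <= u <= cubic_ratio_inv (r + 1) ->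
    derivable_pt cubic_ratio u).
  { intros u Hu. assert (K := cubic_ratio_inv_pos (r - 1)). apply ex_derive_Reals_0.
    eexists; apply is_derive_cubic_ratio; lra. }
  assert (Hrange : cubic_ratio_inv (r - 1) <= cubic_ratio_inv r <= cubic_ratio_inv (r + 1)).
  { split; left; apply Hmono; lra. }
  assert (Hval : derive_pt cubic_ratio t (Hder t Hrange) = 3 * (1 - t ^ 2) ^ 2 / (8 * t ^ 4)).
  { apply derive_pt_eq_0, is_derive_Reals, is_derive_cubic_ratio, Ht. }
  assert (Hnz : 0 < 3 * (1 - t ^ 2) ^ 2 / (8 * t ^ 4)).
  { apply Rdiv_lt_0_compat.
    - assert (0 < (1 - t ^ 2) ^ 2) by (apply pow2_gt_0; nra). lra.
    - assert (0 < t ^ 4) by (apply pow_lt; auto). lra. }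
  rewrite <- Hval, <- Rdiv_1_l. apply is_derive_Reals.
  apply (derivable_pt_lim_recip_interv cubic_ratio cubic_ratio_inv (r - 1) (r + 1) r Hder); try lra.
  - apply continuity_pt_cubic_ratio_inv.
  - intros u _. apply cubic_ratio_invK.
  - fold t. rewrite Hval. lra.
Qed.

(** * Ramanujan's system and the hypergeometric equation *)

Lemma linear_ode_pos (f g : R -> R) (c a b : R) :
  c < a <= b -> (forall t, c < t -> is_derive f t (g t * f t)) ->
  (forall t, c < t -> continuous g t) -> 0 < f a -> 0 < f b.
Proof.
  intros Hab Hf Hg Ha. destruct (proj2 Hab) as [Hlt|<-]; [|exact Ha].
  set (G t := RInt g a t : R).
  assert (HG : forall t, c < t -> is_derive G t (g t)).
  { intros t Ht. apply (is_derive_RInt g G a); [|auto].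
    generalize (open_gt c t Ht). apply filter_imp; intros u Hu.
    apply (RInt_correct (V := R_CompleteNormedModule)), ex_RInt_continuous.
    intros v Hv. apply Hg. apply Rlt_le_trans with (2 := proj1 Hv).
    apply Rmin_glb_lt; lra. }
  assert (E : f a * exp (- G a) = f b * exp (- G b)).
  { apply (eq_is_derive (fun t => f t * exp (- G t))); [|exact Hlt].
    intros t Ht. assert (Df := Hf t ltac:(lra)). assert (DG := HG t ltac:(lra)).
    auto_derive; [repeat split; eexists; eassumption|].
    rewrite_derive Df; rewrite_derive DG. transitivity 0; [ring | reflexivity]. }
  apply Rmult_lt_reg_r with (exp (- G b)); [apply exp_pos|].
  rewrite Rmult_0_l, <- E. apply Rmult_lt_0_compat; [exact Ha | apply exp_pos].
Qed.

Lemma is_derive_0_is_lim (f : R -> R) (a l : R) :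
  (forall t, a <= t -> is_derive f t 0) -> is_lim f p_infty l -> f a = l.
Proof.
  intros Hf Hl. apply Rbar_finite_eq.
  rewrite <- (is_lim_unique _ _ _ Hl), <- (is_lim_unique _ _ _ (is_lim_const (f a) p_infty)).
  apply Lim_ext_loc. exists a; intros t Ht.
  symmetry; apply (eq_is_derive f); [|exact Ht]. intros u Hu. apply Hf; lra.
Qed.

Section RamanujanSystem.
Variables E2 E4 E6 : R -> R.
Hypothesis is_derive_E2 : forall h, 0 < h -> is_derive E2 h (- (E2 h ^ 2 - E4 h) / 12).
Hypothesis is_derive_E4 : forall h, 0 < h -> is_derive E4 h (- (E2 h * E4 h - E6 h) / 3).
Hypothesis is_derive_E6 : forall h, 0 < h -> is_derive E6 h (- (E2 h * E6 h - E4 h ^ 2) / 2).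
Hypothesis E4_pos : forall h, 0 < h -> 0 < E4 h.
Hypothesis is_lim_E2 : is_lim E2 p_infty 1.
Hypothesis is_lim_E4 : is_lim E4 p_infty 1.
Hypothesis is_lim_E6 : is_lim E6 p_infty 1.

Definition discriminant (h : R) : R := E4 h ^ 3 - E6 h ^ 2.

Definition sqrt_E4 (h : R) : R := sqrt (E4 h).
Definition cubic_t (h : R) : R := cubic_ratio_inv (E6 h / sqrt_E4 h ^ 3).
Definition cubic_modulus (h : R) : R := 9 / 8 * (1 - cubic_t h ^ 2).
Definition cubic_theta (h : R) : R := sqrt (sqrt_E4 h / cubic_t h).

Lemma discriminant_pos (h0 h : R) :
  0 < h0 <= h -> 0 < discriminant h0 -> 0 < discriminant h.
Proof.
  intros Hh. apply (linear_ode_pos discriminant (fun t => - E2 t) 0); [exact Hh | |].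
  - intros t Ht. assert (D4 := is_derive_E4 t Ht). assert (D6 := is_derive_E6 t Ht).
    unfold discriminant. auto_derive; [repeat split; eexists; eassumption|].
    rewrite_derive D4; rewrite_derive D6. field.
  - intros t Ht. apply (continuous_opp E2).
    apply ex_derive_continuous. eexists; exact (is_derive_E2 t Ht).
Qed.

Lemma sqrt_E4_pos (h : R) : 0 < h -> 0 < sqrt_E4 h.
Proof. intros Hh. apply sqrt_lt_R0, E4_pos, Hh. Qed.

Lemma sqrt_E4_sq (h : R) : 0 < h -> sqrt_E4 h ^ 2 = E4 h.
Proof. intros Hh. apply pow2_sqrt. left; apply E4_pos, Hh. Qed.

Lemma cubic_t_pos (h : R) : 0 < cubic_t h.
Proof. apply cubic_ratio_inv_pos. Qed.

Lemma E6_cubic (h : R) : 0 < h -> E6 h = sqrt_E4 h ^ 3 * cubic_ratio (cubic_t h).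
Proof.
  intros Hh. unfold cubic_t. rewrite cubic_ratio_invK. assert (K := sqrt_E4_pos h Hh). field. lra.
Qed.

Lemma cubic_t_bounds (h : R) : 0 < h -> 0 < discriminant h -> 1 / 3 < cubic_t h < 1.
Proof.
  intros Hh Hd. assert (Hq := sqrt_E4_pos h Hh).
  assert (Hq3 : 0 < sqrt_E4 h ^ 3) by (apply pow_lt; auto).
  assert (Hsq : (E6 h) ^ 2 < (sqrt_E4 h ^ 3) ^ 2).
  { unfold discriminant in Hd. rewrite <- (sqrt_E4_sq h Hh) in Hd.
    replace ((sqrt_E4 h ^ 3) ^ 2) with ((sqrt_E4 h ^ 2) ^ 3) by ring. lra. }
  assert (Hr : - sqrt_E4 h ^ 3 < E6 h < sqrt_E4 h ^ 3) by (split; simpl in *; nra).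
  unfold cubic_t. split.
  - apply cubic_ratio_inv_gt; [lra|].
    replace (cubic_ratio (1 / 3)) with (-1) by (unfold cubic_ratio; field).
    apply Rlt_div_r; lra.
  - apply cubic_ratio_inv_lt; [lra|].
    replace (cubic_ratio 1) with 1 by (unfold cubic_ratio; field).
    apply Rlt_div_l; lra.
Qed.

Lemma cubic_theta_pos (h : R) : 0 < h -> 0 < cubic_theta h.
Proof.
  intros Hh. apply sqrt_lt_R0, Rdiv_lt_0_compat; [apply sqrt_E4_pos, Hh | apply cubic_t_pos].
Qed.

Lemma cubic_theta_sq (h : R) : 0 < h -> cubic_theta h ^ 2 = sqrt_E4 h / cubic_t h.
Proof.
  intros Hh. apply pow2_sqrt. left.
  apply Rdiv_lt_0_compat; [apply sqrt_E4_pos, Hh | apply cubic_t_pos].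
Qed.

Lemma cubic_modulus_bounds (h : R) :
  0 < h -> 0 < discriminant h -> 0 < cubic_modulus h < 1.
Proof.
  intros Hh Hd. assert (Ht := cubic_t_bounds h Hh Hd). unfold cubic_modulus. simpl. nra.
Qed.

Lemma E4_cubic (h : R) :
  0 < h -> E4 h = cubic_theta h ^ 4 * (1 - 8 / 9 * cubic_modulus h).
Proof.
  intros Hh. replace (cubic_theta h ^ 4) with ((cubic_theta h ^ 2) ^ 2) by ring.
  rewrite cubic_theta_sq, <- (sqrt_E4_sq h Hh) at 1 by exact Hh. unfold cubic_modulus.
  assert (K := cubic_t_pos h). field. lra.
Qed.

Lemma is_derive_sqrt_E4 (h : R) :
  0 < h -> is_derive sqrt_E4 h (- (E2 h * E4 h - E6 h) / (6 * sqrt_E4 h)).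
Proof.
  intros Hh. assert (Hq := sqrt_E4_pos h Hh).
  assert (D := is_derive_sqrt _ _ _ (is_derive_E4 h Hh) (E4_pos h Hh)).
  replace (- (E2 h * E4 h - E6 h) / (6 * sqrt_E4 h)) with
    (- (E2 h * E4 h - E6 h) / 3 / (2 * sqrt_E4 h)) by (field; lra). exact D.
Qed.

Lemma is_derive_cubic_t (h : R) : 0 < h -> 0 < discriminant h ->
  is_derive cubic_t h
    (sqrt_E4 h * (1 - cubic_t h ^ 2) * (9 * cubic_t h ^ 2 - 1) / (48 * cubic_t h ^ 2)).
Proof.
  intros Hh Hd. assert (Ht := cubic_t_bounds h Hh Hd). assert (Hq := sqrt_E4_pos h Hh).
  assert (Hq2 := sqrt_E4_sq h Hh).
  set (r u := E6 u / sqrt_E4 u ^ 3).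
  assert (Dr : is_derive r h (sqrt_E4 h * (1 - r h ^ 2) / 2)).
  { assert (Dq := is_derive_sqrt_E4 h Hh). assert (D6 := is_derive_E6 h Hh).
    unfold r. auto_derive.
    - repeat split; [eexists; exact D6 | eexists; exact Dq|].
      apply (pow_nonzero (sqrt_E4 h) 3); lra.
    - rewrite_derive Dq; rewrite_derive D6. rewrite <- Hq2. field. lra. }
  assert (D := is_derive_comp (V := R_NormedModule) cubic_ratio_inv r h _ _
    (is_derive_cubic_ratio_inv (r h) ltac:(change (cubic_t h <> 1); lra)) Dr).
  change (cubic_ratio_inv (r h)) with (cubic_t h) in D.
  replace (r h) with (cubic_ratio (cubic_t h)) in D by apply cubic_ratio_invK.
  replace (sqrt_E4 h * _ * _ / _) with
    (scal (sqrt_E4 h * (1 - cubic_ratio (cubic_t h) ^ 2) / 2)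
      (/ (3 * (1 - cubic_t h ^ 2) ^ 2 / (8 * cubic_t h ^ 4)))); [exact D|].
  unfold scal; simpl; unfold mult; simpl. unfold cubic_ratio.
  set (t := cubic_t h) in *. assert (0 < 1 - t ^ 2) by (simpl; nra). field. lra.
Qed.

Lemma is_derive_cubic_modulus (h : R) : 0 < h -> 0 < discriminant h ->
  is_derive cubic_modulus h
    (- (cubic_theta h ^ 2 * cubic_modulus h * (1 - cubic_modulus h) / 3)).
Proof.
  intros Hh Hd. assert (D := is_derive_cubic_t h Hh Hd). assert (K := cubic_t_pos h).
  rewrite cubic_theta_sq by exact Hh. unfold cubic_modulus.
  auto_derive; [eexists; exact D|]. rewrite_derive D. field. lra.
Qed.

Lemma is_derive_cubic_theta (h : R) : 0 < h -> 0 < discriminant h ->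
  is_derive cubic_theta h
    (- (cubic_theta h * (E2 h - cubic_theta h ^ 2 * (1 - 4 / 3 * cubic_modulus h)) / 12)).
Proof.
  intros Hh Hd. assert (Ht := cubic_t_pos h). assert (Hq := sqrt_E4_pos h Hh).
  assert (Ha := cubic_theta_pos h Hh). assert (Ha2 := cubic_theta_sq h Hh).
  set (A u := sqrt_E4 u / cubic_t u).
  assert (DA : is_derive A h (- (A h * (E2 h - A h * (1 - 4 / 3 * cubic_modulus h)) / 6))).
  { assert (Dt := is_derive_cubic_t h Hh Hd). assert (Dq := is_derive_sqrt_E4 h Hh).
    assert (Hq2 := sqrt_E4_sq h Hh). assert (H6 := E6_cubic h Hh).
    unfold A, cubic_modulus.
    auto_derive; [repeat split; [eexists; exact Dq | eexists; exact Dt | lra]|].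
    rewrite_derive Dq; rewrite_derive Dt. rewrite H6, <- Hq2. unfold cubic_ratio. field. lra. }
  assert (D := is_derive_sqrt _ _ _ DA (Rdiv_lt_0_compat _ _ Hq Ht)).
  change (sqrt (A h)) with (cubic_theta h) in D. change (A h) with (sqrt_E4 h / cubic_t h) in D.
  rewrite <- Ha2 in D.
  replace (- (cubic_theta h * _ / 12)) with
    (- (cubic_theta h ^ 2 * (E2 h - cubic_theta h ^ 2 * (1 - 4 / 3 * cubic_modulus h)) / 6)
     / (2 * cubic_theta h)) by (field; lra). exact D.
Qed.

Let F := hyp2F1 (1/3) (2/3) 1.
Let F' := hyp2F1' (1/3) (2/3) 1.
Let F'' := hyp2F1'' (1/3) (2/3) 1.

Lemma cubic_hyp2F1_pos (x : R) : 0 <= x < 1 -> 0 < F x.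
Proof. apply hyp2F1_pos; lra. Qed.

Lemma is_derive_cubic_hyp2F1 (x : R) : Rabs x < 1 -> is_derive F x (F' x).
Proof. apply is_derive_hyp2F1; lra. Qed.

Lemma is_derive_cubic_hyp2F1' (x : R) : Rabs x < 1 -> is_derive F' x (F'' x).
Proof. apply is_derive_hyp2F1'; lra. Qed.

Lemma cubic_hypergeometric_equation (x : R) : Rabs x < 1 ->
  x * (1 - x) * F'' x + (1 - 2 * x) * F' x - 2 / 9 * F x = 0.
Proof.
  intros Hx. transitivity (x * (1 - x) * F'' x + (1 - (1/3 + 2/3 + 1) * x) * F' x
    - 1/3 * (2/3) * F x); [field | apply hypergeometric_equation; auto; lra].
Qed.

(* The Wronskian of [cubic_theta] and [F o cubic_modulus], up to the factor that makes it
   constant. *)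
Definition cubic_wronskian (h : R) : R :=
  - F (cubic_modulus h) * (E2 h - cubic_theta h ^ 2 * (1 - 4 / 3 * cubic_modulus h))
    / (12 * cubic_theta h)
  + F' (cubic_modulus h) * cubic_theta h * cubic_modulus h * (1 - cubic_modulus h) / 3.

Lemma is_derive_cubic_wronskian (h : R) :
  0 < h -> 0 < discriminant h -> is_derive cubic_wronskian h 0.
Proof.
  intros Hh Hd. assert (Ha := cubic_theta_pos h Hh). assert (H4 := E4_cubic h Hh).
  assert (Hx := cubic_modulus_bounds h Hh Hd).
  assert (Dx := is_derive_cubic_modulus h Hh Hd). assert (Da := is_derive_cubic_theta h Hh Hd).
  assert (D2 := is_derive_E2 h Hh).
  assert (Hxa : Rabs (cubic_modulus h) < 1) by (rewrite Rabs_pos_eq; lra).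
  assert (DF := is_derive_cubic_hyp2F1 _ Hxa). assert (DF' := is_derive_cubic_hyp2F1' _ Hxa).
  assert (HE := cubic_hypergeometric_equation _ Hxa).
  unfold cubic_wronskian. auto_derive.
  - repeat split; try (eexists; eassumption); lra.
  - rewrite_derive Da; rewrite_derive Dx; rewrite_derive D2; rewrite_derive DF; rewrite_derive DF'.
    rewrite H4.
    set (x := cubic_modulus h) in *. set (a := cubic_theta h) in *.
    transitivity (- (a ^ 3 * x * (1 - x) / 9) *
      (x * (1 - x) * F'' x + (1 - 2 * x) * F' x - 2 / 9 * F x)).
    + field. lra.
    + rewrite HE. ring.
Qed.

Lemma is_derive_cubic_theta_quotient (h : R) : 0 < h -> 0 < discriminant h ->
  is_derive (fun u => cubic_theta u / F (cubic_modulus u)) h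
    (cubic_theta h ^ 2 * cubic_wronskian h / F (cubic_modulus h) ^ 2).
Proof.
  intros Hh Hd. assert (Ha := cubic_theta_pos h Hh).
  assert (Hx := cubic_modulus_bounds h Hh Hd).
  assert (Dx := is_derive_cubic_modulus h Hh Hd). assert (Da := is_derive_cubic_theta h Hh Hd).
  assert (Hxa : Rabs (cubic_modulus h) < 1) by (rewrite Rabs_pos_eq; lra).
  assert (DF := is_derive_cubic_hyp2F1 _ Hxa).
  assert (HF := cubic_hyp2F1_pos (cubic_modulus h) ltac:(lra)).
  unfold cubic_wronskian. auto_derive.
  - repeat split; try (eexists; eassumption); lra.
  - rewrite_derive Da; rewrite_derive Dx; rewrite_derive DF. field. lra.
Qed.

Lemma is_lim_sqrt_E4 : is_lim sqrt_E4 p_infty 1.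
Proof.
  rewrite <- sqrt_1. exact (is_lim_comp_continuous E4 sqrt p_infty 1 is_lim_E4 (continuous_sqrt 1)).
Qed.

Lemma is_lim_cubic_t : is_lim cubic_t p_infty 1.
Proof.
  assert (E : cubic_ratio 1 = 1) by (unfold cubic_ratio; field).
  assert (E' : cubic_ratio_inv 1 = 1) by (rewrite <- E at 1; apply cubic_ratioK; lra).
  replace (Finite 1) with (Finite (cubic_ratio_inv 1)) by (rewrite E'; reflexivity).
  apply (is_lim_comp_continuous (fun h => E6 h / sqrt_E4 h ^ 3) cubic_ratio_inv);
    [|apply continuity_pt_filterlim, continuity_pt_cubic_ratio_inv].
  replace 1 with (1 * / 1 ^ 3) by field.
  apply (filterlim_Rmult (F := Rbar_locally' p_infty)); [exact is_lim_E6|].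
  apply filterlim_Rinv; [simpl; lra | apply filterlim_Rpow; exact is_lim_sqrt_E4].
Qed.

Lemma is_lim_cubic_modulus : is_lim cubic_modulus p_infty 0.
Proof.
  replace 0 with (9 / 8 * (1 + - 1 ^ 2)) by ring.
  apply (filterlim_Rmult (F := Rbar_locally' p_infty)); [apply filterlim_const|].
  apply filterlim_Rplus; [apply filterlim_const|].
  apply filterlim_Ropp, filterlim_Rpow; exact is_lim_cubic_t.
Qed.

Lemma is_lim_cubic_theta : is_lim cubic_theta p_infty 1.
Proof.
  rewrite <- sqrt_1. apply (is_lim_comp_continuous (fun h => sqrt_E4 h / cubic_t h) sqrt);
    [|apply continuous_sqrt].
  replace 1 with (1 * / 1) by field.
  apply (filterlim_Rmult (F := Rbar_locally' p_infty)); [exact is_lim_sqrt_E4|].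
  apply filterlim_Rinv; [lra | exact is_lim_cubic_t].
Qed.

Lemma is_lim_F_cubic_modulus : is_lim (fun h => F (cubic_modulus h)) p_infty 1.
Proof.
  replace (Finite 1) with (Finite (F 0)) by (f_equal; apply hyp2F1_0).
  apply is_lim_comp_continuous; [exact is_lim_cubic_modulus|].
  eapply continuity_pt_filterlim, is_derive_continuity_pt, is_derive_cubic_hyp2F1.
  rewrite Rabs_R0; lra.
Qed.

Lemma is_lim_cubic_wronskian : is_lim cubic_wronskian p_infty 0.
Proof.
  assert (LF' : is_lim (fun h => F' (cubic_modulus h)) p_infty (F' 0)).
  { apply is_lim_comp_continuous; [exact is_lim_cubic_modulus|].
    eapply continuity_pt_filterlim, is_derive_continuity_pt, is_derive_cubic_hyp2F1'.
    rewrite Rabs_R0; lra. }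
  assert (LF := is_lim_F_cubic_modulus). assert (Lx := is_lim_cubic_modulus).
  assert (La := is_lim_cubic_theta).
  replace 0 with (- (1) * (1 + - (1 ^ 2 * (1 + - (4 / 3 * 0)))) * / (12 * 1)
    + F' 0 * 1 * 0 * (1 + - 0) * / 3) by field.
  apply (filterlim_Rplus (F := Rbar_locally' p_infty)).
  - apply filterlim_Rmult; [apply filterlim_Rmult|].
    + apply filterlim_Ropp; exact LF.
    + apply filterlim_Rplus; [exact is_lim_E2 | apply filterlim_Ropp, filterlim_Rmult].
      * apply filterlim_Rpow; exact La.
      * apply filterlim_Rplus; [apply filterlim_const | apply filterlim_Ropp].
        apply filterlim_Rmult; [apply filterlim_const | exact Lx].
    + apply filterlim_Rinv; [lra|]. apply filterlim_Rmult; [apply filterlim_const | exact La].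
  - apply filterlim_Rmult; [|apply filterlim_const].
    apply filterlim_Rmult; [apply filterlim_Rmult; [apply filterlim_Rmult|]|]; auto.
    apply filterlim_Rplus; [apply filterlim_const | apply filterlim_Ropp; exact Lx].
Qed.

Lemma cubic_theta_eq_hyp2F1 (h : R) :
  0 < h -> 0 < discriminant h -> cubic_theta h = hyp2F1 (1/3) (2/3) 1 (cubic_modulus h).
Proof.
  intros Hh Hd.
  assert (Hpos : forall u, h <= u -> 0 < u /\ 0 < discriminant u).
  { intros u Hu. split; [lra | apply (discriminant_pos h); auto]. }
  assert (HW : forall u, h <= u -> cubic_wronskian u = 0).
  { intros u Hu. apply is_derive_0_is_lim; [|exact is_lim_cubic_wronskian].
    intros v Hv. apply is_derive_cubic_wronskian; apply Hpos; lra. }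
  assert (Hquot : cubic_theta h / F (cubic_modulus h) = 1).
  { apply (is_derive_0_is_lim (fun u => cubic_theta u / F (cubic_modulus u))).
    - intros u Hu. destruct (Hpos u Hu) as [Hu0 Hud].
      assert (D := is_derive_cubic_theta_quotient u Hu0 Hud). rewrite HW in D by exact Hu.
      replace (cubic_theta u ^ 2 * 0 / F (cubic_modulus u) ^ 2) with 0 in D
        by (unfold Rdiv; ring). exact D.
    - replace 1 with (1 * / 1) by field.
      apply (filterlim_Rmult (F := Rbar_locally' p_infty)); [exact is_lim_cubic_theta|].
      apply filterlim_Rinv; [lra | exact is_lim_F_cubic_modulus]. }
  assert (Hx := cubic_modulus_bounds h Hh Hd).
  assert (HF := cubic_hyp2F1_pos (cubic_modulus h) ltac:(lra)).
  change (cubic_theta h = F (cubic_modulus h)).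
  transitivity (cubic_theta h / F (cubic_modulus h) * F (cubic_modulus h)); [field; lra|].
  rewrite Hquot; ring.
Qed.

Lemma cubic_parametrization (h A x : R) :
  0 < h -> 0 < A -> 0 < x < 1 ->
  E4 h = A ^ 2 * (1 - 8 / 9 * x) -> E6 h = A ^ 3 * (1 - 4 / 3 * x + 8 / 27 * x ^ 2) ->
  sqrt A = hyp2F1 (1/3) (2/3) 1 x.
Proof.
  intros Hh HA Hx H4 H6.
  assert (Hd : 0 < discriminant h).
  { unfold discriminant. rewrite H4, H6.
    replace ((A ^ 2 * (1 - 8 / 9 * x)) ^ 3 - (A ^ 3 * (1 - 4 / 3 * x + 8 / 27 * x ^ 2)) ^ 2)
      with (64 / 729 * A ^ 6 * (x ^ 3 * (1 - x))) by field.
    repeat apply Rmult_lt_0_compat; lra. }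
  set (t := sqrt (1 - 8 / 9 * x)).
  assert (Ht : 0 < t) by (apply sqrt_lt_R0; lra).
  assert (Ht2 : t ^ 2 = 1 - 8 / 9 * x) by (apply pow2_sqrt; lra).
  assert (Hq : sqrt_E4 h = A * t).
  { unfold sqrt_E4. rewrite H4, <- Ht2, <- Rpow_mult_distr. apply sqrt_pow2.
    apply Rmult_le_pos; lra. }
  assert (Et : cubic_t h = t).
  { unfold cubic_t. rewrite <- (cubic_ratioK t Ht). f_equal. rewrite Hq, H6.
    replace x with (9 / 8 * (1 - t ^ 2)) by lra. unfold cubic_ratio. field. lra. }
  assert (Htheta : cubic_theta h = sqrt A).
  { unfold cubic_theta. f_equal. rewrite Hq, Et. field. lra. }
  rewrite <- Htheta, cubic_theta_eq_hyp2F1 by assumption.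
  f_equal. unfold cubic_modulus. rewrite Et, Ht2. field.
Qed.

End RamanujanSystem.

Lemma half_period_hyp2F1 (Om s M x : R) :
  0 < Om -> 0 < s -> 0 < M -> 0 < x < 1 ->
  has_invariants (Om, 0) (0, s) (4 / 3 * M ^ 4 * (1 - 8 / 9 * x))
    (- (8 / 27) * M ^ 6 * (1 - 4 / 3 * x + 8 / 27 * x ^ 2)) ->
  s = PI / (2 * M) * hyp2F1 (1/3) (2/3) 1 x.
Proof.
  intros HOm Hs HM Hx Hinv. assert (HP := PI_RGT_0).
  destruct (invariants_rectangular Om s _ _ HOm Hs Hinv) as [H4 H6].
  set (h := 2 * (PI * Om / s)) in *.
  assert (Hh : 0 < h).
  { apply Rmult_lt_0_compat; [lra|]. apply Rdiv_lt_0_compat; [apply Rmult_lt_0_compat|]; auto. }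
  set (r := 2 * s * M / PI).
  assert (Hr : 0 < r) by (apply Rdiv_lt_0_compat; [repeat apply Rmult_lt_0_compat|]; lra).
  replace (hyp2F1 (1/3) (2/3) 1 x) with r; [unfold r; field; lra|].
  transitivity (sqrt (r ^ 2)); [symmetry; apply sqrt_pow2; lra|].
  apply (cubic_parametrization eisE2 eisE4 eisE6 is_derive_eisE2 is_derive_eisE4 is_derive_eisE6
    eisE4_pos is_lim_eisE2 is_lim_eisE4 is_lim_eisE6 h); try assumption.
  - apply pow_lt; exact Hr.
  - replace (eisE4 h) with (45 * (2 * s / PI) ^ 4 * ((PI / (2 * s)) ^ 4 * (eisE4 h / 45)))
      by (field; lra).
    rewrite <- H4. unfold r. field. lra.
  - replace (eisE6 h) with
      (- (945 / 2) * (2 * s / PI) ^ 6 * (- (PI / (2 * s)) ^ 6 * (2 / 945 * eisE6 h)))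
      by (field; lra).
    rewrite <- H6. unfold r. field. lra.
Qed.

Theorem theorem9 (kappa : R) (Omega Omega' : C) :
  0 < kappa < 1 ->
  let lambda := sqrt (1 - kappa ^ 2) in
  let G2 := 48 * (1 + 8 * kappa ^ 2) in
  let G3 := 64 * (1 - 20 * kappa ^ 2 - 8 * kappa ^ 4) in
  Im Omega = 0 -> 0 < Re Omega ->
  Re Omega' = 0 -> 0 < Im Omega' ->
  has_invariants Omega Omega' G2 G3 ->
  Omega' = Cmult Ci (RtoC (1 / (6 * sqrt 2) * PI
                            * hyp2F1 (1/3) (2/3) 1 (lambda ^ 2))).
Proof.
  intros Hk lambda G2 G3 HI HR HR' HI' Hinv.
  destruct Omega as [Om o2], Omega' as [o1 s]. simpl in HI, HR, HR', HI'. subst o2 o1.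
  assert (Hlambda : lambda ^ 2 = 1 - kappa ^ 2) by (apply pow2_sqrt; nra).
  assert (Hx : 0 < lambda ^ 2 < 1) by (rewrite Hlambda; nra).
  set (M := 3 * sqrt 2).
  assert (HM : 0 < M) by (apply Rmult_lt_0_compat; [lra | apply sqrt_lt_R0; lra]).
  assert (HM2 : M ^ 2 = 18) by (unfold M; rewrite Rpow_mult_distr, pow2_sqrt; lra).
  assert (Hs : s = PI / (2 * M) * hyp2F1 (1/3) (2/3) 1 (lambda ^ 2)).
  { apply (half_period_hyp2F1 Om); try assumption.
    replace (4 / 3 * M ^ 4 * _) with G2; [replace (- (8 / 27) * M ^ 6 * _) with G3; [exact Hinv|]|].
    - replace (M ^ 6) with ((M ^ 2) ^ 3) by ring. rewrite HM2, Hlambda. unfold G3. field.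
    - replace (M ^ 4) with ((M ^ 2) ^ 2) by ring. rewrite HM2, Hlambda. unfold G2. field. }
  rewrite Hs at 1. unfold Cmult, Ci, RtoC, M; simpl.
  f_equal; field; apply Rgt_not_eq, sqrt_lt_R0; lra.
Qed.
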